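(* There exists an algorithm which solves the black-and-white coloring problem on cographs in $O(n^3)$ time; that is, given a cograph $G$ with $n$ vertices and integers $b$ and $w$, the algorithm decides in $O(n^3)$ time whether $G$ has a black-and-white coloring with $b$ black vertices and $w$ white vertices.
   Context: Graphs are finite, simple and undirected. A black-and-white coloring of a graph $G=(V,E)$ with $b$ black and $w$ white vertices is a pair of disjoint sets $B,W\subseteq V$ (the black and the white vertices) with $|B|=b$ and $|W|=w$ such that no vertex of $B$ is adjacent to any vertex of $W$; the vertices outside $B\cup W$ are uncolored. The black-and-white coloring problem takes as input a graph $G$ and integers $b$ and $w$ and asks whether such a coloring exists. A graph is a cograph if it has no induced $P_4$, where $P_4$ is the path with four vertices. Running time is measured in the usual RAM model. *)

(* Defs.v *)
From mathcomp Require Import all_boot all_order all_algebra.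
Set Implicit Arguments.
Unset Strict Implicit.
Unset Printing Implicit Defensive.

Record sgraph (T : finType) := SGraph {
  adj :> rel T;
  adj_sym : symmetric adj;
  adj_irr : irreflexive adj }.

Definition P4_adj : rel 'I_4 := fun i j => (i.+1 == j) || (j.+1 == i).

Lemma P4_sym : symmetric P4_adj.
Proof. by move=> i j; rewrite /P4_adj orbC. Qed.

Lemma P4_irr : irreflexive P4_adj.
Proof. by move=> i; rewrite /P4_adj orbb gtn_eqF. Qed.

Definition P4 : sgraph 'I_4 := SGraph P4_sym P4_irr.

Definition has_induced (S T : finType) (H : sgraph S) (G : sgraph T) : Prop :=
  exists2 f : S -> T, injective f & forall x y, G (f x) (f y) = H x y.

Definition cograph (T : finType) (G : sgraph T) : Prop := ~ has_induced P4 G.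

Definition bw_coloring (T : finType) (G : sgraph T) (b w : int)
    (B W : {set T}) : Prop :=
  [/\ [disjoint B & W], Posz #|B| = b, Posz #|W| = w
    & forall x y, x \in B -> y \in W -> ~~ G x y].

Definition bw_colorable (T : finType) (G : sgraph T) (b w : int) : Prop :=
  exists B W : {set T}, bw_coloring G b w B W.

(* Random access machine with uniform cost and words of logarithmic length:
   a program has integer registers and an integer memory with indirect
   addressing, each instruction takes one time unit, and no register may ever
   hold a value of absolute value greater than a bound M, which [word_bound]
   makes polynomial in the input. *)

Inductive arith := OpAdd | OpSub | OpMul.

Definition eval_arith (o : arith) (x y : int) : int :=
  match o with OpAdd => x + y | OpSub => x - y | OpMul => x * y end%R.

Inductive instr :=
  | Const (r : nat) (z : int)             (* r := z *)
  | Arith (o : arith) (r r1 r2 : nat)     (* r := r1 o r2 *)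
  | Read (r a : nat)                      (* r := memory[a] *)
  | Write (a r : nat)                     (* memory[a] := r *)
  | JumpPos (r l : nat)                   (* if r > 0 then goto l *)
  | Halt (answer : bool).

Definition program := seq instr.

Record state := State { pc : nat; reg : nat -> int; memory : nat -> int }.

Definition update (f : nat -> int) (k : nat) (z : int) : nat -> int :=
  fun i => if i == k then z else f i.

Inductive outcome := Next of state | Answer of bool | Crash.

Definition set_reg (M : nat) (s : state) (r : nat) (z : int) : outcome :=
  if `|z|%N <= M then Next (State (pc s).+1 (update (reg s) r z) (memory s))
  else Crash.

(* A word overflow, a negative address or a jump outside the program crashes
   the machine. *)
Definition step (M : nat) (P : program) (s : state) : outcome :=
  if onth P (pc s) is Some i then
    match i with
    | Const r z => set_reg M s r z
    | Arith o r r1 r2 => set_reg M s r (eval_arith o (reg s r1) (reg s r2))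
    | Read r a =>
        if reg s a is Posz k then set_reg M s r (memory s k) else Crash
    | Write a r =>
        if reg s a is Posz k then
          Next (State (pc s).+1 (reg s) (update (memory s) k (reg s r)))
        else Crash
    | JumpPos r l =>
        Next (State (if (0 < reg s r)%R then l else (pc s).+1)
                    (reg s) (memory s))
    | Halt answer => Answer answer
    end
  else Crash.

(* The answer given within t steps, the halting instruction included;
   None if there is none. *)
Fixpoint run (M : nat) (P : program) (t : nat) (s : state) : option bool :=
  if t is t'.+1 then
    match step M P s with
    | Next s' => run M P t' s'
    | Answer answer => Some answer
    | Crash => None
    end
  else None.

Definition init (x : seq int) : state :=
  State 0 (fun=> 0%R) (fun k => nth 0%R x k).

(* Words of c * log2 N bits, where N exceeds both the length of the input and
   the absolute values of the integers in it. *)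
Definition word_bound (c : nat) (x : seq int) : nat :=
  (size x + \max_(z <- x) `|z|%N + 2) ^ c.

Definition decides_within (c : nat) (P : program) (x : seq int) (t : nat)
    (Q : Prop) : Prop :=
  exists2 answer : bool,
    run (word_bound c x) P t (init x) = Some answer & (answer <-> Q).

(* n, b and w, followed by the adjacency matrix in row-major order. *)
Definition encode (n : nat) (G : sgraph 'I_n) (b w : int) : seq int :=
  [:: Posz n, b, w & [seq Posz (G i j) | i <- enum 'I_n, j <- enum 'I_n]].

Definition bigO (f g : nat -> nat) : Prop :=
  exists c n0, forall n, n0 <= n -> f n <= c * g n.

(* Main.v *)
(** A cograph with at least two vertices has a pair of twins, because a graph
    without induced P4 splits homogeneously into two nonempty parts.  The
    algorithm repeatedly merges a pair of twins [u], [v] into [u]; the living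
    vertices then represent modules that partition the graph, and merging turns
    two modules into their disjoint union or their join.  For each module and
    each [b] a table stores one more than the largest number of white vertices
    compatible with [b] black ones (0 if there is no coloring); for a union the
    tables are combined by a max-plus convolution, and for a join a coloring
    lies in one of the two modules unless one of its colors is absent.  Each
    merge costs O(n^2), twins included: the number of living vertices telling
    [x] and [y] apart is maintained for all pairs. *)

Require Import Defs.
From mathcomp Require Import all_boot all_order all_algebra zify.
Set Implicit Arguments.
Unset Strict Implicit.
Unset Printing Implicit Defensive.

(** * A structured language compiled to the machine *)

(** The bound must hold on a concrete machine with bounded words, so running time and correctness
    are separated. In a language whose only loop runs exactly [n] times, the number of steps is read
    off the syntax, and loop nesting 3 is the cubic bound. Correctness is proved by weakest
    preconditions that also demand that intermediate values fit in a word; one simulation theorem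
    carries both to the compiled code. Merging twins replaces the cotree, a tree structure, by three
    n by n matrices, and the adjacency matrix is used where the input already lies. Storing one more
    than a maximum encodes infeasibility as 0, so that positivity, the only test of the machine,
    detects it. *)

Inductive expr :=
  | Size
  | Lit (z : int)
  | Var (r : nat)
  | Op (o : arith) (e1 e2 : expr)
  | Cell (a : nat) (e1 e2 : expr).

Inductive cmd :=
  | Skip
  | Assign (r : nat) (e : expr)
  | Put (a : nat) (e1 e2 e : expr)
  | Seq (c1 c2 : cmd)
  | If (e : expr) (c1 c2 : cmd)
  | For (r : nat) (c : cmd).

Record env := Env { var : nat -> int; arr : nat -> nat -> nat -> int }.

Definition set_var (s : env) (r : nat) (z : int) : env :=
  Env (update (var s) r z) (arr s).

Definition set_cell (s : env) (a x y : nat) (z : int) : env :=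
  Env (var s) (fun a' => if a' == a then
    fun x' y' => if (x' == x) && (y' == y) then z else arr s a x' y'
    else arr s a').

Fixpoint mods (c : cmd) : seq nat :=
  match c with
  | Skip | Put _ _ _ _ => [::]
  | Assign r _ => [:: r]
  | Seq c1 c2 | If _ c1 c2 => mods c1 ++ mods c2
  | For r c => r :: mods c
  end.

Fixpoint writes (c : cmd) : seq nat :=
  match c with
  | Skip | Assign _ _ => [::]
  | Put a _ _ _ => [:: a]
  | Seq c1 c2 | If _ c1 c2 => writes c1 ++ writes c2
  | For r c => writes c
  end.

(** Obtained once from the syntax of a command, this spares loop invariants the mention of what a
    body leaves alone. *)
Definition frame (vs ws : seq nat) (s s' : env) : Prop :=
  (forall r, r \notin vs -> var s' r = var s r) /\
  (forall a, a \notin ws -> arr s' a = arr s a).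

(** * Weakest preconditions *)

Section Semantics.

Variables M n : nat.

Fixpoint ev (e : expr) (s : env) : int :=
  match e with
  | Size => Posz n
  | Lit z => z
  | Var r => var s r
  | Op o e1 e2 => eval_arith o (ev e1 s) (ev e2 s)
  | Cell a e1 e2 => arr s a `|ev e1 s|%N `|ev e2 s|%N
  end.

Definition in_range (z : int) : Prop := (0 <= z)%R && (z < Posz n)%R.

(** Excludes overflow and cells outside the three arrays. Variables and cell contents carry no bound
    here, since [simulates] keeps them bounded. *)
Fixpoint safe (e : expr) (s : env) : Prop :=
  match e with
  | Size | Var _ => True
  | Lit z => `|z|%N <= M
  | Op o e1 e2 =>
      [/\ safe e1 s, safe e2 s & `|eval_arith o (ev e1 s) (ev e2 s)|%N <= M]
  | Cell a e1 e2 =>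
      [/\ a < 3, safe e1 s, safe e2 s, in_range (ev e1 s) & in_range (ev e2 s)]
  end.

(* Total correctness; a [For] loop counts down from n - 1 to 0. *)
Fixpoint wp (c : cmd) (Q : env -> Prop) (s : env) : Prop :=
  match c with
  | Skip => Q s
  | Assign r e => safe e s /\ Q (set_var s r (ev e s))
  | Put a e1 e2 e =>
      [/\ safe (Cell a e1 e2) s, safe e s
        & Q (set_cell s a `|ev e1 s|%N `|ev e2 s|%N (ev e s))]
  | Seq c1 c2 => wp c1 (wp c2 Q) s
  | If e c1 c2 =>
      safe e s /\ if (0 < ev e s)%R then wp c1 Q s else wp c2 Q s
  | For r c =>
      r \notin mods c /\
      iteri n (fun k R s => wp c R (set_var s r (Posz k))) Q
        (set_var s r (Posz n))
  end.

Lemma wp_mono c (Q Q' : env -> Prop) s :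
  (forall s', Q s' -> Q' s') -> wp c Q s -> wp c Q' s.
Proof.
elim: c Q Q' s => [|r e|a e1 e2 e|c1 IH1 c2 IH2|e c1 IH1 c2 IH2|r c IH]
  Q Q' s QQ' /=.
- exact: QQ'.
- by case=> ? /QQ'.
- by case=> ? ? /QQ'.
- by apply: IH1 => s'; apply: IH2.
- case=> ok; case: ifP => _ H; split=> //; [exact: IH1 H | exact: IH2 H].
- case=> rc H; split=> //; move: {s}(set_var _ _ _) H => s.
  elim: n s => [|k IHk] s /=; first exact: QQ'.
  by apply: IH => s'; apply: IHk.
Qed.

Lemma wp_frame_sub c vs ws Q s0 s :
  {subset mods c <= vs} -> {subset writes c <= ws} -> frame vs ws s0 s ->
  wp c Q s -> wp c (fun s' => Q s' /\ frame vs ws s0 s') s.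
Proof.
elim: c Q s => [|r e|a e1 e2 e|c1 IH1 c2 IH2|e c1 IH1 c2 IH2|r c IH] Q s
  /= Hv Hw [fv fa].
- by [].
- case=> ok HQ; split=> //; split=> //; split=> //= r' r'v.
  rewrite /update; case: eqP => [E|_]; last exact: fv.
  by move: r'v; rewrite Hv // E mem_head.
- case=> ok1 ok2 HQ; split=> //; split=> //; split=> //= a' a'w.
  case: eqP => [E|_]; last exact: fa.
  by move: a'w; rewrite Hw // E mem_head.
- move=> H.
  have [Hv1 Hv2] : {subset mods c1 <= vs} /\ {subset mods c2 <= vs}.
    by split=> x xc; apply: Hv; rewrite mem_cat xc ?orbT.
  have [Hw1 Hw2] : {subset writes c1 <= ws} /\ {subset writes c2 <= ws}.
    by split=> x xc; apply: Hw; rewrite mem_cat xc ?orbT.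
  by apply: wp_mono (IH1 _ _ Hv1 Hw1 _ H) => // s' [H' f']; apply: IH2.
- have [Hv1 Hv2] : {subset mods c1 <= vs} /\ {subset mods c2 <= vs}.
    by split=> x xc; apply: Hv; rewrite mem_cat xc ?orbT.
  have [Hw1 Hw2] : {subset writes c1 <= ws} /\ {subset writes c2 <= ws}.
    by split=> x xc; apply: Hw; rewrite mem_cat xc ?orbT.
  by case=> ok; case: ifP => _ H; split=> //; [apply: IH1 | apply: IH2].
- case=> rc H; split=> //.
  have set_r s1 z : frame vs ws s0 s1 -> frame vs ws s0 (set_var s1 r z).
    case=> f1 f2; split=> //= r' r'v; rewrite /update; case: eqP => [E|_].
      by move: r'v; rewrite Hv // E mem_head.
    exact: f1.
  have {fv fa}: frame vs ws s0 (set_var s r (Posz n)) by exact: set_r.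
  move: {s}(set_var _ _ _) H => s.
  elim: n s => [|k IHk] s /= H f //.
  have {}H := IH _ _ (fun x xc => Hv x (mem_behead (s := r :: mods c) xc)) Hw
    (set_r _ (Posz k) f) H.
  by apply: wp_mono H => s' [H' f']; apply: IHk.
Qed.

Lemma wp_frame c Q s :
  wp c Q s -> wp c (fun s' => Q s' /\ frame (mods c) (writes c) s s') s.
Proof. exact: wp_frame_sub. Qed.

(** [I k] describes the moment when the rounds k - 1, ..., 0 remain. Step and exit both receive the
    frame relative to the state before the loop. *)
Lemma wp_for r c (I : nat -> env -> Prop) Q s :
  r \notin mods c -> I n (set_var s r (Posz n)) ->
  (forall (k : 'I_n) s', frame (r :: mods c) (writes c) s s' -> I k.+1 s' ->
     wp c (I k) (set_var s' r (Posz k))) ->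
  (forall s', frame (r :: mods c) (writes c) s s' -> I 0 s' -> Q s') ->
  wp (For r c) Q s.
Proof.
move=> rc In Istep HQ; split=> //.
have set_r s1 z : frame (r :: mods c) (writes c) s s1 ->
    frame (r :: mods c) (writes c) s (set_var s1 r z).
  case=> f1 f2; split=> //= r'; rewrite inE negb_or => /andP[r'r r'c].
  by rewrite /update (negPf r'r) f1 // inE negb_or r'r.
have: frame (r :: mods c) (writes c) s (set_var s r (Posz n)) by apply: set_r.
move: (leqnn n) (set_var s r _) In; move: {1 3 4}n => m lemn s1.
elim: m lemn s1 => [|k IHk] lekn s1 /= Ik f; first exact: HQ.
have {}Ik := Istep (Ordinal lekn) s1 f Ik.
apply: wp_mono (wp_frame_sub _ _ (set_r _ _ f) Ik) => [s2 [I2 f2]||] //.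
  exact: IHk (ltnW lekn) _ I2 f2.
by move=> x xc; rewrite inE xc orbT.
Qed.

End Semantics.

(** Variable [r] lives in register [2 r], the scratch value number [t >= 1] in
    register [2 t + 1], and register 1 holds the number of vertices. *)

(** Three leading cells hold [n], [b] and [w]; array 0 is then the adjacency matrix in place, and
    arrays 1 and 2 lie behind the input. *)
Definition addr (n a x y : nat) : nat := 3 + ((a * n + x) * n + y).

Definition addr_code (a t : nat) : seq instr :=
  [:: Const t.+2.*2.+1 (Posz a);
      Arith OpMul t.+2.*2.+1 t.+2.*2.+1 1;
      Arith OpAdd t.*2.+1 t.*2.+1 t.+2.*2.+1;
      Arith OpMul t.*2.+1 t.*2.+1 1;
      Arith OpAdd t.*2.+1 t.*2.+1 t.+1.*2.+1;
      Const t.+1.*2.+1 (Posz 3);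
      Arith OpAdd t.*2.+1 t.*2.+1 t.+1.*2.+1].

(** The result goes to scratch value [t] and lower ones are left alone, so a left operand survives
    the evaluation of the right one. Adding 0 serves as the copy instruction. *)
Fixpoint comp_expr (e : expr) (t : nat) : seq instr :=
  match e with
  | Size => [:: Const t.+1.*2.+1 (Posz 0);
                Arith OpAdd t.*2.+1 1 t.+1.*2.+1]
  | Lit z => [:: Const t.*2.+1 z]
  | Var r => [:: Const t.+1.*2.+1 (Posz 0);
                 Arith OpAdd t.*2.+1 r.*2 t.+1.*2.+1]
  | Op o e1 e2 =>
      comp_expr e1 t ++ comp_expr e2 t.+1 ++
      [:: Arith o t.*2.+1 t.*2.+1 t.+1.*2.+1]
  | Cell a e1 e2 =>
      comp_expr e1 t ++ comp_expr e2 t.+1 ++ addr_code a t ++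
      [:: Read t.*2.+1 t.*2.+1]
  end.

(** Jump targets are absolute, hence the code position [o]. The else branch precedes the then branch
    and skips it by a jump on a register just set to 1. A loop is entered at its test, behind the
    body; the decrement starts at [o + 4]. *)
Fixpoint comp (c : cmd) (o : nat) : seq instr :=
  match c with
  | Skip => [::]
  | Assign r e =>
      comp_expr e 1 ++ [:: Const 5 (Posz 0); Arith OpAdd r.*2 3 5]
  | Put a e1 e2 e =>
      comp_expr e1 1 ++ comp_expr e2 2 ++ addr_code a 1 ++ comp_expr e 2 ++
      [:: Write 3 5]
  | Seq c1 c2 =>
      let p1 := comp c1 o in p1 ++ comp c2 (o + size p1)
  | If e c1 c2 =>
      let p := comp_expr e 1 in
      let p2 := comp c2 (o + size p).+1 in
      let o1 := (o + size p + size p2).+3 in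
      let p1 := comp c1 o1 in
      p ++ JumpPos 3 o1 :: p2 ++
      [:: Const 3 (Posz 1), JumpPos 3 (o1 + size p1) & p1]
  | For r c =>
      let p := comp c (o + 6) in
      [:: Const 3 (Posz 0), Arith OpAdd r.*2 1 3, Const 3 (Posz 1),
          JumpPos 3 (o + 6 + size p), Const 3 (Posz 1),
          Arith OpSub r.*2 r.*2 3 & p ++ [:: JumpPos r.*2 (o + 4)]]
  end.

(** For a loop, 5 counts the four instructions before it and the last test, 3 the test and the
    two-instruction decrement of a round. A conditional is charged for both branches. *)
Fixpoint cost (n : nat) (c : cmd) : nat :=
  match c with
  | Skip => 0
  | Assign r e => size (comp_expr e 1) + 2
  | Put a e1 e2 e => size (comp (Put a e1 e2 e) 0)
  | Seq c1 c2 => cost n c1 + cost n c2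
  | If e c1 c2 => size (comp_expr e 1) + cost n c1 + cost n c2 + 3
  | For r c => 5 + n * (cost n c + 3)
  end.

Fixpoint depth (c : cmd) : nat :=
  match c with
  | Skip | Assign _ _ | Put _ _ _ _ => 0
  | Seq c1 c2 | If _ c1 c2 => maxn (depth c1) (depth c2)
  | For r c => (depth c).+1
  end.

(** Each nesting level contributes one factor [n]; everything else is a constant of the code. *)
Lemma cost_bigO c : exists k, forall n, 0 < n -> cost n c <= k * n ^ depth c.
Proof.
have pow_le n i j : 0 < n -> i <= j -> n ^ i <= n ^ j by exact: leq_pexp2l.
elim: c => [|r e|a e1 e2 e|c1 [k1 IH1] c2 [k2 IH2]|e c1 [k1 IH1] c2 [k2 IH2]|
  r c [k IH]].
- by exists 0.
- by exists (size (comp_expr e 1) + 2) => n _; rewrite muln1.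
- by exists (size (comp (Put a e1 e2 e) 0)) => n _; rewrite muln1.
- exists (k1 + k2) => n n0; rewrite mulnDl.
  apply: leq_add; [apply: leq_trans (IH1 n n0) _|apply: leq_trans (IH2 n n0) _].
    by rewrite leq_mul // pow_le // leq_maxl.
  by rewrite leq_mul // pow_le // leq_maxr.
- exists (size (comp_expr e 1) + k1 + k2 + 3) => n n0 /=; rewrite !mulnDl.
  have n1 i : 0 < n ^ i by rewrite expn_gt0 n0.
  rewrite !leq_add ?leq_pmulr //.
    by apply: leq_trans (IH1 n n0) _; rewrite leq_mul // pow_le // leq_maxl.
  by apply: leq_trans (IH2 n n0) _; rewrite leq_mul // pow_le // leq_maxr.
(* As [n >= 1], the overhead [5 + 3 * n] is at most 8 times [n * n ^ depth c]. *)
- exists (k + 8) => n n0 /=; have := IH n n0; rewrite expnS.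
  have : 0 < n ^ depth c by rewrite expn_gt0 n0.
  move: (n ^ _) (cost n c) => N C; nia.
Qed.

Definition reaches (M : nat) (P : program) (t : nat) (s s' : state) : Prop :=
  forall k, run M P (t + k) s = run M P k s'.

Lemma reaches_trans M P t1 t2 s1 s2 s3 :
  reaches M P t1 s1 s2 -> reaches M P t2 s2 s3 ->
  reaches M P (t1 + t2) s1 s3.
Proof. by move=> H1 H2 k; rewrite -addnA H1 H2. Qed.

Definition code_at (P : program) (o : nat) (p : seq instr) : Prop :=
  forall i x, onth p i = Some x -> onth P (o + i) = Some x.

Lemma code_at_cat P o p1 p2 :
  code_at P o (p1 ++ p2) -> code_at P o p1 /\ code_at P (o + size p1) p2.
Proof.
move=> H; split=> i x Hi.
  apply: H; rewrite onth_cat Hi.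
  by rewrite (_ : i < size p1) // -onthTE Hi.
by rewrite -addnA; apply: H; rewrite onth_cat addKn ltnNge leq_addr.
Qed.

Lemma code_at_cons P o i p :
  code_at P o (i :: p) -> onth P o = Some i /\ code_at P o.+1 p.
Proof.
move=> H; split; first by rewrite -[o]addn0; apply: H.
by move=> j x Hj; rewrite addSnnS; apply: H.
Qed.

Lemma updateE f k z i : update f k z i = if i == k then z else f i.
Proof. by []. Qed.

(** * Simulation of commands by compiled code *)

Section Simulation.

Variables (M n : nat) (P : program).
Hypothesis M_large : 3 * n * n + 2 * n + 3 <= M.

(** The word bounds belong to the relation because copying a variable or reading a cell is an
    instruction that could overflow. *)
Definition simulates (e : env) (s : state) : Prop :=
  [/\ reg s 1 = Posz n,
      forall r, reg s r.*2 = var e r,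
      forall a x y, a < 3 -> x < n -> y < n ->
        memory s (addr n a x y) = arr e a x y,
      forall r, `|var e r|%N <= M
    & forall a x y, a < 3 -> x < n -> y < n -> `|arr e a x y|%N <= M].

Lemma reaches_set s r z i p :
  code_at P (pc s) (i :: p) ->
  step M P s = set_reg M s r z -> `|z|%N <= M ->
  exists2 s', reaches M P 1 s s' &
    [/\ code_at P (pc s') p, pc s' = (pc s).+1, memory s' = memory s &
      reg s' = update (reg s) r z].
Proof.
move=> /code_at_cons[_ Pp] Hs Hz.
exists (State (pc s).+1 (update (reg s) r z) (memory s)); last by [].
by move=> k; rewrite /= Hs /set_reg Hz.
Qed.

Lemma run_const s r z p :
  code_at P (pc s) (Const r z :: p) -> `|z|%N <= M ->
  exists2 s', reaches M P 1 s s' &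
    [/\ code_at P (pc s') p, pc s' = (pc s).+1, memory s' = memory s &
      reg s' = update (reg s) r z].
Proof.
move=> Hp; apply: (reaches_set Hp).
by rewrite /step (code_at_cons Hp).1.
Qed.

Lemma run_arith s o r r1 r2 p :
  code_at P (pc s) (Arith o r r1 r2 :: p) ->
  `|eval_arith o (reg s r1) (reg s r2)|%N <= M ->
  exists2 s', reaches M P 1 s s' &
    [/\ code_at P (pc s') p, pc s' = (pc s).+1, memory s' = memory s &
      reg s' = update (reg s) r (eval_arith o (reg s r1) (reg s r2))].
Proof.
move=> Hp; apply: (reaches_set Hp).
by rewrite /step (code_at_cons Hp).1.
Qed.

Lemma run_read s r a k p :
  code_at P (pc s) (Read r a :: p) -> reg s a = Posz k ->
  `|memory s k|%N <= M ->
  exists2 s', reaches M P 1 s s' &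
    [/\ code_at P (pc s') p, pc s' = (pc s).+1, memory s' = memory s &
      reg s' = update (reg s) r (memory s k)].
Proof.
move=> Hp Ha; apply: (reaches_set Hp).
by rewrite /step (code_at_cons Hp).1 Ha.
Qed.

Lemma run_write s a r k p :
  code_at P (pc s) (Write a r :: p) -> reg s a = Posz k ->
  exists2 s', reaches M P 1 s s' &
    [/\ code_at P (pc s') p, pc s' = (pc s).+1, reg s' = reg s &
      memory s' = update (memory s) k (reg s r)].
Proof.
move=> /code_at_cons[H Pp] Ha.
exists (State (pc s).+1 (reg s) (update (memory s) k (reg s r))); last by [].
by move=> j; rewrite /= /step H Ha.
Qed.

Lemma run_jump s r l :
  onth P (pc s) = Some (JumpPos r l) ->
  exists2 s', reaches M P 1 s s' &
    [/\ pc s' = if (0 < reg s r)%R then l else (pc s).+1, reg s' = reg s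
      & memory s' = memory s].
Proof.
move=> H.
exists (State (if (0 < reg s r)%R then l else (pc s).+1) (reg s) (memory s)).
  by move=> j; rewrite /= /step H.
by [].
Qed.

Lemma update_eq f k z : update f k z k = z.
Proof. by rewrite updateE eqxx. Qed.

Lemma update_neq f k z i : i <> k -> update f k z i = f i.
Proof. by move=> /eqP/negPf; rewrite updateE => ->. Qed.

Lemma run_addr s a t x y p :
  code_at P (pc s) (addr_code a t ++ p) -> reg s 1 = Posz n -> 0 < t ->
  reg s t.*2.+1 = Posz x -> reg s t.+1.*2.+1 = Posz y ->
  a < 3 -> x < n -> y < n ->
  exists2 s', reaches M P 7 s s' &
    [/\ code_at P (pc s') p, pc s' = pc s + 7, memory s' = memory s,
      reg s' t.*2.+1 = Posz (addr n a x y)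
    & forall r, ~~ odd r || (r < t.*2.+1) -> reg s' r = reg s r].
Proof.
move=> Hp Hn t0 Hx Hy a3 xn yn; rewrite /= in Hp.
have yM : addr n a x y <= M by rewrite /addr; nia.
have aM : a <= M by lia.
have anM : a * n <= M by nia.
have anxM : (a * n + x) <= M by nia.
have anxnM : (a * n + x) * n <= M by nia.
have anxnyM : (a * n + x) * n + y <= M by nia.
have [s1 R1 [{}Hp c1 m1 r1]] := run_const Hp aM.
have [|s2 R2 [{}Hp c2 m2 r2]] := run_arith Hp.
  by rewrite r1 /= !update_eq update_neq ?Hn //; lia.
have E2 : reg s2 t.+2.*2.+1 = Posz (a * n).
  by rewrite r2 update_eq r1 /= update_eq update_neq ?Hn //; lia.
have F2 r : r <> t.+2.*2.+1 -> reg s2 r = reg s r.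
  by move=> ?; rewrite r2 r1 !update_neq.
have [|s3 R3 [{}Hp c3 m3 r3]] := run_arith Hp.
  by rewrite /= E2 F2 ?Hx; lia.
have [|s4 R4 [{}Hp c4 m4 r4]] := run_arith Hp.
  rewrite r3 /= update_eq update_neq ?E2 ?F2 ?Hx ?Hn; try lia.
have E4 : reg s4 t.*2.+1 = Posz ((a * n + x) * n).
  rewrite r4 update_eq r3 /= update_eq update_neq ?E2 ?F2 ?Hx ?Hn; lia.
have F4 r : r <> t.+2.*2.+1 -> r <> t.*2.+1 -> reg s4 r = reg s r.
  by move=> ? ?; rewrite r4 r3 !update_neq ?F2.
have [|s5 R5 [{}Hp c5 m5 r5]] := run_arith Hp.
  rewrite /= E4 F4 ?Hy; lia.
have E5 : reg s5 t.*2.+1 = Posz ((a * n + x) * n + y).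
  by rewrite r5 update_eq /= E4 F4 ?Hy; lia.
have [|s6 R6 [{}Hp c6 m6 r6]] := run_const Hp; first by lia.
have [|s7 R7 [{}Hp c7 m7 r7]] := run_arith Hp.
  rewrite r6 /= update_eq update_neq ?E5; rewrite /addr in yM; lia.
exists s7.
  have := reaches_trans (reaches_trans (reaches_trans R1 R2)
    (reaches_trans R3 R4)) (reaches_trans (reaches_trans R5 R6) R7).
  by [].
split=> //.
- lia.
- by rewrite m7 m6 m5 m4 m3 m2 m1.
- rewrite r7 update_eq r6 /= update_eq update_neq ?E5 /addr; lia.
- move=> r Hr.
  rewrite r7 update_neq; last by lia.
  rewrite r6 update_neq; last by lia.
  rewrite r5 update_neq; last by lia.
  by rewrite F4 //; lia.
Qed.

(** Even registers hold the variables and odd registers below [t.*2.+1] the pending operands; the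
    binary cases of the induction need both preserved. *)
Lemma run_expr e s0 s t p :
  safe M n e s0 -> simulates s0 s -> 0 < t ->
  code_at P (pc s) (comp_expr e t ++ p) ->
  exists2 s', reaches M P (size (comp_expr e t)) s s' &
    [/\ code_at P (pc s') p, pc s' = pc s + size (comp_expr e t),
      memory s' = memory s, reg s' t.*2.+1 = ev n e s0
    & forall r, ~~ odd r || (r < t.*2.+1) -> reg s' r = reg s r].
Proof.
move=> ok [Hn Hv Ha bv ba].
have bev : forall e, safe M n e s0 -> `|ev n e s0|%N <= M.
  case=> //= [_|o e1 e2 [] //|a e1 e2 []]; first by nia.
  by move=> a3 _ _; rewrite /in_range => H1 H2; apply: ba; lia.
elim: e s t p ok Hn Hv Ha => [|z|r|o e1 IH1 e2 IH2|a e1 IH1 e2 IH2] s t p ok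
  Hn Hv Ha t0 Hp.
- have [|s1 R1 [{}Hp c1 m1 r1]] := run_const Hp; first by [].
  have [|s2 R2 [{}Hp c2 m2 r2]] := run_arith Hp.
    by rewrite r1 /= update_eq update_neq ?Hn; nia.
  exists s2; first exact: reaches_trans R1 R2.
  split=> //=; first by lia.
  + by rewrite m2.
  + by rewrite r2 update_eq r1 /= update_eq update_neq ?Hn; lia.
  + by move=> r Hr; rewrite r2 r1 !update_neq //; lia.
- have [s1 R1 [{}Hp c1 m1 r1]] := run_const Hp ok.
  exists s1 => //; split=> //=; first by lia.
  + by rewrite r1 update_eq.
  + by move=> r Hr; rewrite r1 update_neq //; lia.
- have [|s1 R1 [{}Hp c1 m1 r1]] := run_const Hp; first by [].
  have Er : reg s1 r.*2 = var s0 r by rewrite r1 update_neq ?Hv //; lia.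
  have Et : reg s1 t.+1.*2.+1 = Posz 0 by rewrite r1 update_eq.
  have := bv r => bvr.
  have [|s2 R2 [{}Hp c2 m2 r2]] := run_arith Hp; first by rewrite /= Er Et; lia.
  exists s2; first exact: reaches_trans R1 R2.
  split=> //=; first by lia.
  + by rewrite m2.
  + by rewrite r2 update_eq /= Er Et; lia.
  + by move=> r' Hr; rewrite r2 r1 !update_neq //; lia.
- case: ok => ok1 ok2 bo.
  rewrite /= -!catA in Hp.
  have [s1 R1 [{}Hp c1 m1 r1 f1]] := IH1 _ _ _ ok1 Hn Hv Ha t0 Hp.
  have [||||s2 R2 [{}Hp c2 m2 r2 f2]] := IH2 _ _ _ ok2 _ _ _ _ Hp.
  + by rewrite f1 //; lia.
  + by move=> r; rewrite f1 ?Hv //; lia.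
  + by rewrite m1.
  + by [].
  have E1 : reg s2 t.*2.+1 = ev n e1 s0 by rewrite f2 ?r1 //; lia.
  have [|s3 R3 [{}Hp c3 m3 r3]] := run_arith Hp; first by rewrite E1 r2.
  exists s3.
    by rewrite !size_cat; apply: reaches_trans R1 (reaches_trans R2 R3).
  split=> //.
  + by rewrite /= !size_cat /=; lia.
  + by rewrite m3 m2.
  + by rewrite r3 update_eq E1 r2.
  + by move=> r Hr; rewrite r3 update_neq ?f2 ?f1 //; lia.
- case: ok => a3 ok1 ok2 i1 i2.
  rewrite /= -!catA in Hp.
  have [s1 R1 [{}Hp c1 m1 r1 f1]] := IH1 _ _ _ ok1 Hn Hv Ha t0 Hp.
  have [||||s2 R2 [{}Hp c2 m2 r2 f2]] := IH2 _ _ _ ok2 _ _ _ _ Hp.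
  + by rewrite f1 //; lia.
  + by move=> r; rewrite f1 ?Hv //; lia.
  + by rewrite m1.
  + by [].
  have E1 : reg s2 t.*2.+1 = ev n e1 s0 by rewrite f2 ?r1 //; lia.
  move: i1 i2; rewrite /in_range => i1 i2.
  have [||||||| s3 R3 [{}Hp c3 m3 r3 f3]] :=
    run_addr (x := `|ev n e1 s0|) (y := `|ev n e2 s0|) Hp.
  + by rewrite f2 ?f1 //; lia.
  + by [].
  + by rewrite E1; lia.
  + by rewrite r2; lia.
  + by [].
  + by lia.
  + by lia.
  have [|s4 R4 [{}Hp c4 m4 r4]] := run_read Hp r3.
    by rewrite m3 m2 m1 Ha ?ba; lia.
  exists s4.
    rewrite !size_cat; apply: reaches_trans R1 _; apply: reaches_trans R2 _.
    exact: reaches_trans R3 R4.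
  split=> //.
  + by rewrite /= !size_cat /=; lia.
  + by rewrite m4 m3 m2.
  + by rewrite r4 update_eq m3 m2 m1 Ha //; lia.
  + by move=> r Hr; rewrite r4 update_neq ?f3 ?f2 ?f1 //; lia.
Qed.

Lemma simulates_frame e s s' :
  simulates e s -> memory s' = memory s ->
  (forall r, ~~ odd r || (r < 3) -> reg s' r = reg s r) -> simulates e s'.
Proof.
case=> Hn Hv Ha bv ba Hm Hr; split=> //.
- by rewrite Hr.
- by move=> r; rewrite Hr ?Hv //; lia.
- by rewrite Hm.
Qed.

Lemma simulates_set_var e s s' r z :
  simulates e s -> memory s' = memory s -> `|z|%N <= M ->
  reg s' r.*2 = z ->
  (forall r', ~~ odd r' || (r' < 3) -> r' <> r.*2 -> reg s' r' = reg s r') ->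
  simulates (set_var e r z) s'.
Proof.
case=> Hn Hv Ha bv ba Hm Hz Er Hr; split=> //=.
- by rewrite Hr //; lia.
- move=> r'; rewrite updateE; case: eqP => [->//|rr].
  by rewrite Hr ?Hv //; lia.
- by rewrite Hm.
- by move=> r'; rewrite updateE; case: eqP.
Qed.

(** Up to the offset 3, an address is a numeral in base [n] with last digits [x] and [y]; division
    with remainder recovers them. *)
Lemma addr_inj a x y a' x' y' :
  x < n -> y < n -> x' < n -> y' < n ->
  addr n a x y = addr n a' x' y' -> [/\ a = a', x = x' & y = y'].
Proof.
move=> xn yn xn' yn' /addnI H.
have n0 : 0 < n by apply: leq_ltn_trans xn.
have E : a * n + x = a' * n + x'.
  by have := congr1 (divn^~ n) H; rewrite !divnMDl // !divn_small // !addn0.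
split.
- by have := congr1 (divn^~ n) E; rewrite !divnMDl // !divn_small // !addn0.
- by have := congr1 (modn^~ n) E; rewrite !modnMDl !modn_small.
- by have := congr1 (modn^~ n) H; rewrite !modnMDl !modn_small.
Qed.

Lemma simulates_set_cell e s s' a x y z :
  simulates e s -> x < n -> y < n -> `|z|%N <= M ->
  memory s' = update (memory s) (addr n a x y) z ->
  (forall r, ~~ odd r || (r < 3) -> reg s' r = reg s r) ->
  simulates (set_cell e a x y z) s'.
Proof.
case=> Hn Hv Ha bv ba xn yn Hz Hm Hr; split=> //=.
- by rewrite Hr.
- by move=> r; rewrite Hr ?Hv //; lia.
- move=> a' x' y' a3 xn' yn'; rewrite Hm updateE.
  case: eqP => [/addr_inj[]// -> -> ->|ne]; first by rewrite !eqxx.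
  case: eqP a3 ne => [->|_] a3; last by move=> _; apply: Ha.
  case: eqP => [->|_ _]; last exact: Ha.
  by case: eqP => [-> /(_ erefl)|_ _] //; exact: Ha.
- move=> a' x' y' a3 xn' yn'; case: eqP a3 => [->|_] a3; last exact: ba.
  by case: ifP => _ //; exact: ba.
Qed.

Lemma safe_bound e s0 s :
  simulates s0 s -> safe M n e s0 -> `|ev n e s0|%N <= M.
Proof.
case=> Hn Hv Ha bv ba; case: e => //= [_|o e1 e2 [] //|a e1 e2 []].
  by nia.
by move=> a3 _ _; rewrite /in_range => H1 H2; apply: ba; lia.
Qed.

(** The exit state is existential since a weakest precondition does not name it. The step count may
    fall short of [cost], as only one branch of a conditional runs. *)
Lemma run_cmd c Q s0 s p :
  wp M n c Q s0 -> simulates s0 s ->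
  code_at P (pc s) (comp c (pc s) ++ p) ->
  exists t s' s0', [/\ t <= cost n c /\ reaches M P t s s',
    code_at P (pc s') p, pc s' = pc s + size (comp c (pc s)),
    Q s0' & simulates s0' s'].
Proof.
elim: c Q s0 s p => [|r e|a e1 e2 e|c1 IH1 c2 IH2|e c1 IH1 c2 IH2|r c IH]
  Q s0 s p /=.
- move=> HQ Hs Hp; exists 0, s, s0; split=> //; lia.
- case=> ok HQ Hs; rewrite -catA => Hp.
  have [s1 R1 [{}Hp c1 m1 r1 f1]] := run_expr (t := 1) ok Hs isT Hp.
  have [|s2 R2 [{}Hp c2 m2 r2]] := run_const Hp; first by [].
  have b := safe_bound Hs ok.
  have [|s3 R3 [{}Hp c3 m3 r3]] := run_arith Hp.
    by rewrite r2 /= update_eq update_neq ?r1; lia.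
  exists (size (comp_expr e 1) + 2), s3, (set_var s0 r (ev n e s0)).
  split=> //.
  + split=> //; apply: reaches_trans R1 _; exact: reaches_trans R2 R3.
  + by rewrite size_cat /=; lia.
  + apply: simulates_set_var Hs _ b _ _.
    * by rewrite m3 m2.
    * by rewrite r3 update_eq r2 /= update_eq update_neq ?r1; lia.
    * move=> r' Hr' ne; rewrite r3 update_neq // r2 update_neq ?f1 //; lia.
- case=> -[a3 ok1 ok2 i1 i2] ok HQ Hs; rewrite -!catA => Hp.
  have b := safe_bound Hs ok.
  move: i1 i2; rewrite /in_range => i1 i2.
  have [s1 R1 [{}Hp c1 m1 r1 f1]] := run_expr (t := 1) ok1 Hs isT Hp.
  have Hs1 : simulates s0 s1 by apply: simulates_frame Hs m1 f1.
  have [s2 R2 [{}Hp c2 m2 r2 f2]] := run_expr (t := 2) ok2 Hs1 isT Hp.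
  have Hs2 : simulates s0 s2.
    by apply: simulates_frame Hs1 m2 _ => r Hr; rewrite f2 //; lia.
  have [||||||| s3 R3 [{}Hp c3 m3 r3 f3]] :=
    run_addr (x := `|ev n e1 s0|) (y := `|ev n e2 s0|) Hp.
  + by case: Hs2.
  + by [].
  + by rewrite f2 // r1; lia.
  + by rewrite r2; lia.
  + by [].
  + by lia.
  + by lia.
  have Hs3 : simulates s0 s3.
    by apply: simulates_frame Hs2 m3 _ => r Hr; rewrite f3 //; lia.
  have {}Hp : code_at P (pc s3) ((comp_expr e 2 ++ [:: Write 3 5]) ++ p).
    exact: Hp.
  rewrite -catA in Hp.
  have [s4 R4 [{}Hp c4 m4 r4 f4]] := run_expr (t := 2) ok Hs3 isT Hp.
  have Hs4 : simulates s0 s4.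
    by apply: simulates_frame Hs3 m4 _ => r Hr; rewrite f4 //; lia.
  have E4 : reg s4 3 = Posz (addr n a `|ev n e1 s0| `|ev n e2 s0|).
    by rewrite f4 // r3.
  have [s5 R5 [{}Hp c5 m5 r5]] := run_write Hp E4.
  exists (size (comp_expr e1 1) + (size (comp_expr e2 2) +
    (7 + (size (comp_expr e 2) + 1)))), s5,
    (set_cell s0 a `|ev n e1 s0| `|ev n e2 s0| (ev n e s0)).
  split=> //.
  + split; first by rewrite !size_cat /= size_cat /=; lia.
    apply: reaches_trans R1 _; apply: reaches_trans R2 _.
    by apply: reaches_trans R3 _; apply: reaches_trans R4 R5.
  + by rewrite !size_cat /= size_cat /=; lia.
  + apply: (simulates_set_cell Hs4) => //; try lia.
      by rewrite r5 r4.
    by move=> r Hr; rewrite m5.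
- move=> H Hs; rewrite -!catA => Hp.
  have [t1 [s1 [s01 [[le1 R1] {}Hp c1E H1 Hs1]]]] := IH1 _ _ _ _ H Hs Hp.
  rewrite -c1E in Hp.
  have [t2 [s2 [s02 [[le2 R2] {}Hp c2E H2 Hs2]]]] := IH2 _ _ _ _ H1 Hs1 Hp.
  exists (t1 + t2), s2, s02; split=> //.
  + split; [by lia | exact: reaches_trans R1 R2].
  + by rewrite size_cat c2E c1E addnA.
- case=> ok H Hs; set p2 := comp c2 _; set o1 := (_ + _).+3.
  rewrite -!catA /= -catA /= => Hp.
  have [s1 R1 [{}Hp c1E m1 r1 f1]] := run_expr (t := 1) ok Hs isT Hp.
  have Hs1 : simulates s0 s1 by apply: simulates_frame Hs m1 f1.
  have [J Hp2] := code_at_cons Hp.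
  have [s2 R2 [c2E r2 m2]] := run_jump J.
  have Hs2 : simulates s0 s2.
    by apply: simulates_frame Hs1 m2 _ => r _; rewrite r2.
  move: c2E H; rewrite r1; case: ifP => e0 c2E H.
  + have [_ /code_at_cons[_ /code_at_cons[_]]] := code_at_cat Hp2.
    rewrite (_ : _.+2 = pc s2); last by rewrite c2E /o1; lia.
    rewrite -c2E => Hp1.
    have [t3 [s3 [s03 [[le3 R3] Hp3 c3E H3 Hs3]]]] := IH1 _ _ _ _ H Hs2 Hp1.
    exists (size (comp_expr e 1) + (1 + t3)), s3, s03; split=> //.
    * split; last by apply: reaches_trans R1 _; apply: reaches_trans R2 R3.
      by lia.
    * by move: c2E; rewrite c3E !size_cat /= size_cat /= /o1; lia.
  + rewrite -c2E in Hp2.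
    rewrite /p2 (_ : (pc s + _).+1 = pc s2) in Hp2; last by lia.
    have [t3 [s3 [s03 [[le3 R3] Hp3 c3E H3 Hs3]]]] := IH2 _ _ _ _ H Hs2 Hp2.
    have [|s4 R4 [{}Hp3 c4E m4 r4]] := run_const Hp3; first by lia.
    have [J2 _] := code_at_cons Hp3.
    have [s5 R5 [c5E r5 m5]] := run_jump J2.
    have Hs5 : simulates s03 s5.
      apply: simulates_frame Hs3 _ _; first by rewrite m5.
      by move=> r Hr; rewrite r5 r4 update_neq //; lia.
    rewrite r4 update_eq /= in c5E.
    exists (size (comp_expr e 1) + (1 + (t3 + (1 + 1)))), s5, s03; split=> //.
    * split; first by lia.
      apply: reaches_trans R1 _; apply: reaches_trans R2 _.
      by apply: reaches_trans R3 _; apply: reaches_trans R4 R5.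
    * have [_ /code_at_cons[_ /code_at_cons[_ /code_at_cat[_]]]] :=
        code_at_cat (code_at_cons Hp).2.
      by rewrite c5E /o1; congr code_at; lia.
    * by rewrite c5E /o1 size_cat /= size_cat /=; lia.
- case=> rc H Hs; set body := comp c _; rewrite -catA => Hp.
  have Hp0 := Hp.
  have [|s1 R1 [{}Hp c1 m1 r1]] := run_const Hp; first by [].
  have r1n : reg s1 1 = Posz n by rewrite r1 update_neq //; case: Hs.
  have [|s2 R2 [{}Hp c2 m2 r2]] := run_arith Hp.
    by rewrite r1n r1 update_eq /=; nia.
  have [|s3 R3 [{}Hp c3 m3 r3]] := run_const Hp; first by lia.
  have [J _] := code_at_cons Hp.
  have [s4 R4 [c4 r4 m4]] := run_jump J.
  rewrite r3 update_eq /= in c4.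
  have Hs4 : simulates (set_var s0 r (Posz n)) s4.
    apply: (simulates_set_var Hs).
    + by rewrite m4 m3 m2.
    + by nia.
    + rewrite r4 r3 update_neq ?r2 ?update_eq ?r1n /= ?r1 ?update_eq; lia.
    + move=> r' Hr' ne; rewrite r4 r3 update_neq; last by lia.
      by rewrite r2 update_neq // r1 update_neq //; lia.
  have R : reaches M P 4 s s4.
    by apply: reaches_trans R1 _; apply: reaches_trans R2 (reaches_trans R3 R4).
  have var_r : var (set_var s0 r (Posz n)) r = Posz n by rewrite /= update_eq.
  have [_ /code_at_cons[_ /code_at_cons[_ /code_at_cons[_ Hb]]]] :=
    code_at_cons Hp0.
  have [_ /code_at_cons[_ Hb2]] := code_at_cons Hb.
  have [_ Ht] := code_at_cat Hb2.
  have {}Ht : code_at P (pc s + 6 + size body) (JumpPos r.*2 (pc s + 4) :: p).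
    by move: Ht; rewrite !addnS !addSn addn0.
  have [Jt Hend] := code_at_cons Ht.
  (* The induction starts at the test behind the body, with [r] holding the number [k] of rounds
     still to run. *)
  suff loop k s0' s' :
      iteri k (fun k R s => wp M n c R (set_var s r (Posz k))) Q s0' ->
      simulates s0' s' -> var s0' r = Posz k -> k <= n ->
      pc s' = pc s + 6 + size body ->
    exists t s'' s0'', [/\ t <= 1 + k * (cost n c + 3) /\ reaches M P t s' s'',
      pc s'' = pc s + 7 + size body, Q s0'' & simulates s0'' s''].
    have [t [s5 [s05 [[le5 R5] c5 H5 Hs5]]]] :=
      loop _ _ _ H Hs4 var_r (leqnn n) c4.
    exists (4 + t), s5, s05; split=> //.
    + split; [by lia | exact: reaches_trans R R5].
    + by rewrite c5; move: Hend; congr code_at; lia.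
    + by rewrite c5 size_cat /=; lia.
  elim: k s0' s' => [|k IHk] s0' s' H' Hs' vk lekn c'.
    rewrite -c' in Jt.
    have [s5 R5 [c5 r5 m5]] := run_jump Jt.
    exists 1, s5, s0'; split=> //.
      by case: Hs' c5 => _ -> _ _ _; rewrite vk /= => ->; lia.
    by apply: simulates_frame Hs' m5 _ => r' _; rewrite r5.
  have Jt' := Jt; rewrite -c' in Jt'.
  have [s5 R5 [c5 r5 m5]] := run_jump Jt'.
  have [Hn' Hv' _ _ _] := Hs'.
  rewrite Hv' vk /= in c5.
  have Hb' : code_at P (pc s5) [:: Const 3 (Posz 1), Arith OpSub r.*2 r.*2 3
      & body ++ JumpPos r.*2 (pc s + 4) :: p].
    by move: Hb; rewrite c5; congr code_at; lia.
  have [|s6 R6 [{}Hb' c6 m6 r6]] := run_const Hb'; first by lia.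
  have E6 : reg s6 r.*2 = Posz k.+1.
    by rewrite r6 update_neq ?r5 ?Hv' //; lia.
  have E6' : reg s6 3 = Posz 1 by rewrite r6 update_eq.
  have [|s7 R7 [{}Hb' c7 m7 r7]] := run_arith Hb'.
    by rewrite E6 E6' /=; nia.
  have Hs7 : simulates (set_var s0' r (Posz k)) s7.
    apply: (simulates_set_var Hs').
    + by rewrite m7 m6.
    + by nia.
    + by rewrite r7 update_eq E6 E6' /=; lia.
    + by move=> r' Hr' ne; rewrite r7 update_neq // r6 update_neq ?r5 //; lia.
  have c7' : pc s7 = pc s + 6 by lia.
  rewrite /body -c7' in Hb'.
  (* The frame shows that the body leaves the counter [r] unchanged, as the next test requires. *)
  have H7 := wp_frame H'.
  have [t8 [s8 [s08 [[le8 R8] Hb8 c8 [H8 f8] Hs8]]]] := IH _ _ _ _ H7 Hs7 Hb'.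
  have [||t9 [s9 [s09 [[le9 R9] c9 H9 Hs9]]]] :=
    IHk s08 s8 H8 Hs8 _ (ltnW lekn).
  + by rewrite f8.1 // /= update_eq.
  + by rewrite c8 c7'.
  exists (1 + (1 + (1 + (t8 + t9)))), s9, s09; split=> //; split.
    by rewrite mulSn; lia.
  apply: reaches_trans R5 _; apply: reaches_trans R6 _.
  by apply: reaches_trans R7 _; apply: reaches_trans R8 R9.
Qed.

End Simulation.
(** * Twins in cographs *)

Section Twins.

Variables (T : finType) (G : sgraph T).

(** [P4] is self-complementary: for [c = true] the edges form the path x3, x1, x4, x2. The parameter
    lets later arguments treat unions and joins at once. *)
Lemma cograph_no_P4 c x1 x2 x3 x4 :
  cograph G -> uniq [:: x1; x2; x3; x4] ->
  G x1 x2 = ~~ c -> G x2 x3 = ~~ c -> G x3 x4 = ~~ c ->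
  G x1 x3 = c -> G x2 x4 = c -> G x1 x4 = c -> False.
Proof.
have path y1 y2 y3 y4 : cograph G -> uniq [:: y1; y2; y3; y4] ->
    G y1 y2 -> G y2 y3 -> G y3 y4 -> G y1 y3 = false -> G y2 y4 = false ->
    G y1 y4 = false -> False.
  move=> coG U e12 e23 e34 e13 e24 e14; apply: coG.
  exists (tnth [tuple y1; y2; y3; y4]).
    by apply/tuple_uniqP.
  have s := adj_sym G; have i := adj_irr G.
  case=> [[|[|[|[|//]]]] ?] [[|[|[|[|//]]]] ?];
    rewrite !(tnth_nth y1) /P4_adj /= ?i ?e12 ?e23 ?e34 ?e13 ?e24 ?e14 //;
    by rewrite s ?e12 ?e23 ?e34 ?e13 ?e24 ?e14.
move=> coG; case: c => U e12 e23 e34 e13 e24 e14; last first.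
  exact: (path x1 x2 x3 x4).
apply: (path x3 x1 x4 x2) => //; rewrite ?(adj_sym G x3) ?(adj_sym G x4) //.
by move: U; rewrite /= !inE !negb_or (eq_sym x3 x1) (eq_sym x3 x2)
  (eq_sym x4 x2) => /and4P[/and3P[-> -> ->] /andP[-> ->] ->].
Qed.

(* Both sides of a homogeneous split of [A :\ v] are tried in turn: a vertex
   [x] that v sees as the split does and a vertex [y] that it does not, joined
   against the split, lie on the same side, and v then sees the other side as
   the split does, since a vertex [z] there gives the path [x y v z]. *)
Lemma homogeneous_split (A : {set T}) :
  cograph G -> 1 < #|A| ->
  exists (X : {set T}) c, [/\ X \proper A, X != set0
    & forall x y, x \in X -> y \in A :\: X -> G x y = c].
Proof.
move=> coG; have [k leAk] := ubnP #|A|.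
elim: k A leAk => // k IH A leAk A1.
have /card_gt0P[v vA] : 0 < #|A| by apply: ltnW.
have cA := cardsD1 v A; rewrite vA in cA.
have single c : (forall u, u \in A :\ v -> G v u = c) -> exists (X : {set T}) c,
    [/\ X \proper A, X != set0 &
      forall x y, x \in X -> y \in A :\: X -> G x y = c].
  move=> Hc; exists [set v], c; split.
  - by rewrite properEcard sub1set vA cards1.
  - by apply/set0Pn; exists v; rewrite inE.
  - by move=> x y /set1P ->; apply: Hc.
have [le1|gt1] := leqP #|A :\ v| 1.
  have /card_gt0P[u uA] : 0 < #|A :\ v| by lia.
  apply: (single (G v u)) => u' u'A; congr (G v _).
  by apply/(card_le1_eqP le1).
have [||X [c [XA /set0Pn[x0 x0X] Xc]]] := IH (A :\ v) => //; first by lia.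
have vx x : x \in A :\ v -> x != v by rewrite !inE => /andP[].
have side (X1 X2 : {set T}) x y : A :\ v = X1 :|: X2 -> [disjoint X1 & X2] ->
    X2 != set0 ->
    (forall x y, x \in X1 -> y \in X2 -> G x y = c) ->
    x \in X1 -> y \in A :\ v -> G v x = c -> G v y = ~~ c -> G x y = ~~ c ->
    exists (X : {set T}) c, [/\ X \proper A, X != set0
      & forall x y, x \in X -> y \in A :\: X -> G x y = c].
  move=> EA dis X20 H12 xX1 yA vxc vyc xyc.
  have yX1 : y \in X1.
    move: yA; rewrite EA inE => /orP[//|yX2].
    by move: xyc; rewrite H12 //; case: (c).
  have inA z : z \in A = (z == v) || (z \in X1) || (z \in X2).
    by rewrite -orbA -in_setU -EA !inE; case: eqP => // ->.
  have vX1 : v \notin X1.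
    by apply/negP => vX1; have := vx v; rewrite EA inE vX1 eqxx => /(_ isT).
  exists X2, c; split=> //.
    apply/properP; split.
      by apply/subsetP => z; rewrite inA => ->; rewrite orbT.
    by exists v => //; apply/negP => vX2;
      have := vx v; rewrite EA inE vX2 orbT eqxx => /(_ isT).
  move=> z w zX2; rewrite inE inA => /andP[wX2]; rewrite (negPf wX2) orbF.
  case/orP => [/eqP->|wX1]; last by rewrite (adj_sym G) H12.
  rewrite (adj_sym G); apply/eqP; apply/negPn/negP => vz.
  have {}vz : G v z = ~~ c by move: vz; case: (G v z); case: (c).
  have yvc : G y v = ~~ c by rewrite (adj_sym G).
  have xvc : G x v = c by rewrite (adj_sym G).
  apply: (cograph_no_P4 coG _ xyc yvc vz xvc (H12 _ _ yX1 zX2)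
    (H12 _ _ xX1 zX2)).
  have zA : z \in A :\ v by rewrite EA inE zX2 orbT.
  have xA : x \in A :\ v by rewrite EA inE xX1.
  rewrite /= !inE !negb_or (eq_sym v z) (vx x) // (vx y) // (vx z) //= !andbT.
  rewrite -andbA; apply/and3P; split.
  - by apply/eqP => E; move: vxc; rewrite E vyc; case: (c).
  - by apply/eqP => E; move: dis; rewrite disjoint_subset => /subsetP/(_ _ xX1);
      rewrite inE E zX2.
  - by apply/eqP => E; move: dis; rewrite disjoint_subset => /subsetP/(_ _ yX1);
      rewrite inE E zX2.
pose N := [set x in A :\ v | G v x == c].
have [/existsP[x /existsP[y]]|] := boolP [exists x, exists y,
    [&& x \in N, y \in A :\ v, y \notin N & G x y == ~~ c]].
  rewrite !inE; case/and4P => /andP[xA /eqP vxc] /andP[yv yA].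
  rewrite yv yA /= => vyc /eqP xyc.
  have {}vyc : G v y = ~~ c by move: vyc; case: (G v y); case: (c).
  have EA : A :\ v = X :|: ((A :\ v) :\: X).
    by rewrite -{1}(setID (A :\ v) X) (setIidPr _) // proper_sub.
  have dis : [disjoint X & (A :\ v) :\: X].
    by rewrite -setI_eq0 setIDA setIC -setIDA setDv setI0.
  have yA' : y \in A :\ v by rewrite !inE yv.
  have [xX|xX] := boolP (x \in X).
    apply: (side X _ x y EA dis) => //.
    by apply/set0Pn; have /properP[_ [z zA zX]] := XA; exists z; rewrite inE zX.
  apply: (side ((A :\ v) :\: X) X x y) => //.
  - by rewrite setUC.
  - by rewrite disjoint_sym.
  - by apply/set0Pn; exists x0.
  - by move=> x' y' x'X y'X; rewrite (adj_sym G); apply: Xc.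
  - by rewrite !inE xX.
(* No conflicting pair is left, so [N], the vertices that [v] sees with value [c], sees all the rest
   of [A] with value [c], including [v]. If [N] is empty, [v] itself splits off. *)
move=> /existsPn H.
have [/eqP N0|N0] := boolP (N == set0).
  apply: (single (~~ c)) => u uA.
  have := in_set0 u; rewrite -N0 inE uA /=; case: (G v u); case: (c) => //.
exists N, c; split=> //.
  apply/properP; split; last by exists v => //; rewrite !inE eqxx.
  by apply/subsetP => z; rewrite !inE => /andP[/andP[]].
move=> x y xN; rewrite inE => /andP[yN yA].
have [->|yv] := eqVneq y v.
  by move: xN; rewrite (adj_sym G) inE => /andP[_ /eqP].
have := H x; rewrite negb_exists => /forallP/(_ y).
rewrite xN yN !inE yv yA /=; case: (G x y); case: (c) => //.
Qed.

(** A side of a homogeneous split with two or more vertices contains twins by induction, and they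
    stay twins in [A] because each vertex of the other side sees them alike. If both sides are
    singletons, there is no third vertex. *)
Lemma cograph_twins (A : {set T}) :
  cograph G -> 1 < #|A| ->
  exists x y, [/\ x \in A, y \in A, x != y
    & forall z, z \in A -> z != x -> z != y -> G x z = G y z].
Proof.
move=> coG; have [k leAk] := ubnP #|A|.
elim: k A leAk => // k IH A leAk A1.
have [X [c [XA X0 Xc]]] := homogeneous_split coG A1.
have part (Y Z : {set T}) : A = Y :|: Z -> #|Y| < #|A| -> 1 < #|Y| ->
    (forall x y, x \in Y -> y \in Z -> G x y = c) ->
    exists x y, [/\ x \in A, y \in A, x != y
      & forall z, z \in A -> z != x -> z != y -> G x z = G y z].
  move=> EA YA Y1 YZ.
  have [|x [y [xY yY xy H]]] := IH Y _ Y1; first by lia.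
  exists x, y; rewrite EA !inE xY yY; split=> // z.
  by rewrite inE => /orP[zY|zZ] zx zy; [apply: H | rewrite !YZ].
have EA : A = X :|: (A :\: X).
  by rewrite -{1}(setID A X) (setIidPr _) // proper_sub.
have cA : #|A| = #|X| + #|A :\: X|.
  by rewrite -(cardsID X A) (setIidPr _) // proper_sub.
have c1 := proper_card XA.
rewrite -card_gt0 in X0.
have [X1|X1] := ltnP 1 #|X|; first exact: (part X (A :\: X)).
have [Y1|Y1] := ltnP 1 #|A :\: X|.
  apply: (part (A :\: X) X) => //; [by rewrite setUC | by lia |].
  by move=> x y xY yX; rewrite (adj_sym G); apply: Xc.
have /cards1P[x Ex] : #|X| == 1 by lia.
have /cards1P[y Ey] : #|A :\: X| == 1 by lia.
have xX : x \in X by rewrite Ex inE.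
have : y \in A :\: X by rewrite Ey inE.
rewrite inE => /andP[yX yA].
exists x, y; split=> //.
- by rewrite EA inE xX.
- by apply: contraNneq yX => <-.
- by move=> z; rewrite EA Ey Ex !inE => /orP[] ->.
Qed.

Definition diff (S : {set T}) (x y : T) : nat :=
  \sum_(z in S) (G x z (+) G y z).

Lemma diff_setD1 (S : {set T}) z x y :
  z \in S -> diff S x y = (G x z (+) G y z) + diff (S :\ z) x y.
Proof. by move=> zS; rewrite /diff (big_setD1 z). Qed.

Lemma diff_setT_le x y : diff [set: T] x y <= #|T|.
Proof.
by rewrite -sum1_card /diff big_mkcond leq_sum // => z _; rewrite inE leq_b1.
Qed.

Lemma diff_le (S : {set T}) x y : diff S x y <= #|T|.
Proof.
apply: leq_trans (diff_setT_le x y).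
rewrite /diff big_mkcond [leqRHS]big_mkcond.
by apply: leq_sum => z _; rewrite inE; case: ifP.
Qed.

(* The terms [z = x] and [z = y] of [diff S x y] contribute [2 * G x y]. *)
Lemma twins_diffP (S : {set T}) x y :
  x \in S -> y \in S -> x != y ->
  reflect (forall z, z \in S -> z != x -> z != y -> G x z = G y z)
    (diff S x y <= 2 * G x y).
Proof.
move=> xS yS xy; rewrite (diff_setD1 _ _ xS) (@diff_setD1 _ y); last first.
  by rewrite !inE eq_sym xy.
rewrite !(adj_irr G) addFb addbF (adj_sym G y x) addnA addnn -mul2n.
rewrite -{2}[2 * _]addn0 leq_add2l leqn0 /diff sum_nat_eq0.
apply: (iffP forall_inP) => H z.
  move=> zS zx zy; have := H z; rewrite !inE zx zy zS eqb0 => /(_ isT).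
  by case: (G x z); case: (G y z).
rewrite !inE => /and3P[zy zx zS].
by rewrite H // addbb.
Qed.

End Twins.

(** * Colorings of modules *)

Section Coloring.

Variables (T : finType) (G : sgraph T).

Definition col (M : {set T}) (b w : nat) : Prop :=
  exists B W : {set T}, [/\ B \subset M, W \subset M & bw_coloring G b w B W].

(* [z] is one more than the largest possible number of white vertices, and 0 if
   there is no coloring with [b] black vertices. *)
Definition is_max (M : {set T}) (b : nat) (z : int) : Prop :=
  (0 <= z)%R /\ forall w : nat, col M b w <-> (Posz w < z)%R.

Lemma exists_subset (M : {set T}) k :
  k <= #|M| -> exists2 B : {set T}, B \subset M & #|B| = k.
Proof.
move=> kM; have : 0 < #|[set B : {set T} | (B \subset M) && (#|B| == k)]|.
  by rewrite cards_draws bin_gt0.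
by case/card_gt0P => B; rewrite inE => /andP[BM /eqP]; exists B.
Qed.

Lemma col_colorable b w :
  col [set: T] b w <-> bw_colorable G (Posz b) (Posz w).
Proof.
split=> [[B [W [_ _ H]]]|[B [W H]]]; first by exists B, W.
by exists B, W; rewrite !subsetT.
Qed.

Lemma col_card M b w : col M b w -> b + w <= #|M|.
Proof.
case=> B [W [BM WM [d [<-] [<-] _]]]; rewrite -cardsUI.
move: d; rewrite -setI_eq0 => /eqP ->.
by rewrite cards0 addn0 subset_leq_card // subUset BM.
Qed.

Lemma col_white M w : col M 0 w <-> w <= #|M|.
Proof.
split=> [/col_card//|/exists_subset[W WM cW]].
exists set0, W; split=> //; rewrite ?sub0set //; split; rewrite ?cards0 ?cW //.
  by rewrite -setI_eq0 set0I.
by move=> x y; rewrite inE.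
Qed.

Lemma col_black M b : col M b 0 <-> b <= #|M|.
Proof.
split=> [/col_card|/exists_subset[B BM cB]]; first by rewrite addn0.
exists B, set0; split=> //; rewrite ?sub0set //; split; rewrite ?cards0 ?cB //.
  by rewrite -setI_eq0 setI0.
by move=> x y; rewrite inE.
Qed.

Lemma col_sub (M M' : {set T}) b w : M \subset M' -> col M b w -> col M' b w.
Proof.
move=> MM' [B [W [BM WM H]]]; exists B, W.
by rewrite (subset_trans BM) ?(subset_trans WM).
Qed.

Lemma col_union (M1 M2 : {set T}) b w :
  [disjoint M1 & M2] ->
  (forall x y, x \in M1 -> y \in M2 -> G x y = false) ->
  col (M1 :|: M2) b w <->
  exists b1 w1, [/\ b1 <= b, w1 <= w, col M1 b1 w1 & col M2 (b - b1) (w - w1)].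
Proof.
move=> dis H12.
have dI : M1 :&: M2 = set0 by apply/eqP; rewrite setI_eq0.
have split_card (B : {set T}) :
    B \subset M1 :|: M2 -> #|B| = #|B :&: M1| + #|B :&: M2|.
  move=> /setIidPl {1}<-; rewrite setIUr cardsU setIACA dI setI0 cards0.
  by rewrite subn0.
split=> [[B [W [BM WM [d [<-] [<-] H]]]]|].
  exists #|B :&: M1|, #|W :&: M1|.
  rewrite (split_card B) // (split_card W) // !leq_addr !addKn; split=> //.
    exists (B :&: M1), (W :&: M1); rewrite !subsetIr; split=> //; split=> //.
      by apply: disjointWl (subsetIl _ _) (disjointWr (subsetIl _ _) d).
    by move=> x y /setIP[xB _] /setIP[yW _]; apply: H.
  exists (B :&: M2), (W :&: M2); rewrite !subsetIr; split=> //; split=> //.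
    by apply: disjointWl (subsetIl _ _) (disjointWr (subsetIl _ _) d).
  by move=> x y /setIP[xB _] /setIP[yW _]; apply: H.
case=> b1 [w1 [lb lw [B1 [W1 [B1M W1M [d1 [cB1] [cW1] H1]]]]
  [B2 [W2 [B2M W2M [d2 [cB2] [cW2] H2]]]]]].
have cross (X Y : {set T}) : X \subset M1 -> Y \subset M2 -> X :&: Y = set0.
  by move=> XM YM; apply/eqP; rewrite -subset0 -dI setISS.
have n12 x y : x \in M1 -> y \in M2 -> ~~ G x y.
  by move=> xM yM; rewrite H12.
exists (B1 :|: B2), (W1 :|: W2); rewrite !setUSS //; split=> //; split.
- move: d1 d2; rewrite -!setI_eq0 => /eqP d1 /eqP d2.
  rewrite setIUr !setIUl d1 d2 (cross B1 W2) // (setIC B2) (cross W1 B2) //.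
  by rewrite !setU0.
- by rewrite cardsU cross // cards0 cB1 cB2; congr Posz; lia.
- by rewrite cardsU cross // cards0 cW1 cW2; congr Posz; lia.
- move=> x y /setUP[xB|xB] /setUP[yW|yW].
  + exact: H1.
  + by apply: n12; [exact: subsetP xB | exact: subsetP yW].
  + by rewrite (adj_sym G); apply: n12; [exact: subsetP yW | exact: subsetP xB].
  + exact: H2.
Qed.

(** A black vertex in one part forces all white ones into that part, and a white one then forces all
    black ones there. With [w = 0] any [b] vertices will do; the symmetric exception [b = 0] is left
    to [is_max_white]. *)
Lemma col_join (M1 M2 : {set T}) b w :
  0 < b -> (forall x y, x \in M1 -> y \in M2 -> G x y) ->
  col (M1 :|: M2) b w <->
  [\/ w = 0 /\ b <= #|M1 :|: M2|, col M1 b w | col M2 b w].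
Proof.
move=> b0 H12; split; last first.
  case=> [[-> ?]|H|H]; first exact/col_black.
    exact: col_sub (subsetUl _ _) H.
  exact: col_sub (subsetUr _ _) H.
case: w => [|w] H; first by constructor 1; have /col_black := H.
case: H => B [W [BM WM [d cB cW H]]].
have /card_gt0P[x xB] : 0 < #|B| by case: cB => ->.
have /card_gt0P[y yW] : 0 < #|W| by case: cW => ->.
have {b0}side (M M' : {set T}) : M :|: M' = M1 :|: M2 ->
    (forall x y, x \in M -> y \in M' -> G x y) -> x \in M -> col M b w.+1.
  move=> EM HM xM; rewrite -EM in BM WM.
  have {}WM : W \subset M.
    apply/subsetP => z zW; have := subsetP WM z zW; rewrite inE.
    by case/orP => // zM'; have := H x z xB zW; rewrite HM.
  have {}BM : B \subset M.
    apply/subsetP => z zB; have := subsetP BM z zB; rewrite inE.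
    case/orP => // zM'; have := H z y zB yW.
    by rewrite (adj_sym G) HM // (subsetP WM).
  by exists B, W.
have := subsetP BM x xB; rewrite inE => /orP[xM|xM].
  by constructor 2; apply: (side M1 M2).
constructor 3; apply: (side M2 M1) => //; first by rewrite setUC.
by move=> x' y' x'M y'M; rewrite (adj_sym G) H12.
Qed.

Lemma is_max_le M b z : is_max M b z -> (z <= Posz #|M|.+1)%R.
Proof.
case=> z0 Hz; have [//|lt] := boolP (z <= Posz #|M|.+1)%R.
have /Hz/col_card : (Posz #|M|.+1 < z)%R by lia.
lia.
Qed.

(** Without black vertices any set may be white, so entry 0 records the size of the module and is
    always positive. *)
Lemma is_max_white M z : is_max M 0 z <-> z = Posz #|M|.+1.
Proof.
split=> [H|->]; last first.
  by split=> // w; rewrite col_white; lia.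
have := is_max_le H; case: H => z0 Hz.
have : (Posz #|M| < z)%R by apply/Hz/col_white.
lia.
Qed.

Lemma is_max_single u b :
  is_max [set u] b
    (if b == 0 then Posz 2 else if b == 1 then Posz 1 else Posz 0).
Proof.
case: eqP => [->|b0]; first by apply/is_max_white; rewrite cards1.
split=> [|w]; first by case: ifP.
split=> [H|].
  by have := col_card H; rewrite cards1; case: eqP; lia.
case: eqP => [->|_]; last by lia.
by case: w => [_|w]; [apply/col_black; rewrite cards1 | lia].
Qed.

(** Describing [z] by the [w] below it avoids naming a maximum over feasible pairs. Both entries are
    one too large and the result should be one too large once, hence the -1. *)
Lemma is_max_union (M1 M2 : {set T}) (g1 g2 : nat -> int) b z :
  [disjoint M1 & M2] ->
  (forall x y, x \in M1 -> y \in M2 -> G x y = false) ->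
  (forall k, k <= b -> is_max M1 k (g1 k)) ->
  (forall k, k <= b -> is_max M2 k (g2 k)) ->
  (0 <= z)%R ->
  (forall w : nat, (Posz w < z)%R <-> exists k, [/\ k <= b, (0 < g1 k)%R,
     (0 < g2 (b - k)%N)%R & (Posz w < g1 k + g2 (b - k)%N - 1)%R]) ->
  is_max (M1 :|: M2) b z.
Proof.
move=> dis H12 H1 H2 z0 Hz; split=> // w.
rewrite Hz.
rewrite col_union //; split=> [[b1 [w1 [lb lw c1 c2]]]|[k [lk p1 p2 lw]]].
  have /(proj2 (H1 _ lb)) := c1.
  have /(proj2 (H2 _ (leq_subr b1 b))) := c2.
  by move=> ? ?; exists b1; split=> //; lia.
have [_ E1] := H1 _ lk; have [_ E2] := H2 _ (leq_subr k b).
(* The first module takes as many of the [w] white vertices as it can, so the remainder fits into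
   the second. *)
exists k, (minn w (absz (g1 k) - 1)); split=> //; first exact: geq_minl.
  by apply/E1; lia.
by apply/E2; lia.
Qed.

Lemma is_max_join (M1 M2 : {set T}) (g1 g2 z : int) b :
  0 < b -> (forall x y, x \in M1 -> y \in M2 -> G x y) ->
  is_max M1 b g1 -> is_max M2 b g2 -> (0 <= z)%R ->
  (forall w : nat, (Posz w < z)%R <->
    [\/ w = 0 /\ b <= #|M1 :|: M2|, (Posz w < g1)%R | (Posz w < g2)%R]) ->
  is_max (M1 :|: M2) b z.
Proof.
move=> b0 H12 [_ H1] [_ H2] z0 Hz; split=> // w.
rewrite Hz col_join //.
split=> -[H|/H1 H|/H2 H].
- by constructor 1.
- by constructor 2.
- by constructor 3.
- by constructor 1.
- by constructor 2.
- by constructor 3.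
Qed.

Lemma bw_colorable_nat (b w : int) :
  bw_colorable G b w -> (0 <= b)%R && (0 <= w)%R.
Proof. by case=> B [W [_ <- <- _]]. Qed.

End Coloring.
(** * The algorithm *)

Notation vb := 0 (only parsing).
Notation vw := 1 (only parsing).
Notation vx := 2 (only parsing).
Notation vy := 3 (only parsing).
Notation vz := 4 (only parsing).
Notation vu := 5 (only parsing).
Notation vv := 6 (only parsing).
Notation vfound := 7 (only parsing).
Notation vacc := 8 (only parsing).
Notation vsign := 9 (only parsing).
Notation viter := 10 (only parsing).
Notation vtotal := 11 (only parsing).
Notation adjacency := 0 (only parsing).
Notation diffs := 1 (only parsing).
Notation table := 2 (only parsing).

Declare Scope expr_scope.
Delimit Scope expr_scope with X.
Bind Scope expr_scope with expr.
Notation "e1 + e2" := (Op OpAdd e1 e2) : expr_scope.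
Notation "e1 - e2" := (Op OpSub e1 e2) : expr_scope.
Notation "e1 * e2" := (Op OpMul e1 e2) : expr_scope.
Notation "c1 ;; c2" := (Seq c1 c2) (at level 90, right associativity).

Definition when (e : expr) (c : cmd) : cmd := If e c Skip.

(** The square of the difference of two adjacency bits is their exclusive or; the sign adds or
    removes the contribution of [vz]. *)
Definition shift_row : cmd :=
  let d := (Cell adjacency (Var vx) (Var vz)
            - Cell adjacency (Var vy) (Var vz))%X in
  For vy (Put diffs (Var vx) (Var vy)
    (Cell diffs (Var vx) (Var vy) + Var vsign * (d * d))%X).

Definition shift : cmd := For vx shift_row.

(** Vertices enter the counts one at a time. For [n = 1] there is no column 1, hence the guard. *)
Definition setup : cmd :=
  Assign vsign (Lit 1) ;;
  For vz (
    Put table (Var vz) (Lit 0) (Lit 2) ;;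
    when (Size - Lit 1)%X (Put table (Var vz) (Lit 1) (Lit 1)) ;;
    shift).

(** Pairs with [y < x] suffice by symmetry. The innermost test is the inequality of [twins_diffP]
    turned into positivity. *)
Definition find_row : cmd :=
  For vy (
    when (Var vx - Var vy)%X (
    when (Cell table (Var vx) (Lit 0)) (
    when (Cell table (Var vy) (Lit 0)) (
    when (Lit 1 - Cell diffs (Var vx) (Var vy)
          + Lit 2 * Cell adjacency (Var vx) (Var vy))%X (
      Assign vu (Var vx) ;; Assign vv (Var vy) ;; Assign vfound (Lit 1)))))).

Definition find_twins : cmd := Assign vfound (Lit 0) ;; For vx find_row.

(** [vtotal] is the joint size plus one. The value 1 stands for the coloring without white vertices;
    column 0, where white vertices may lie in both modules, is overwritten at the end. *)
Definition join_table : cmd :=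
  Assign vtotal
    (Cell table (Var vu) (Lit 0) + Cell table (Var vv) (Lit 0) - Lit 1)%X ;;
  For vy (
    Assign vacc (Lit 0) ;;
    when (Var vtotal - Var vy)%X (Assign vacc (Lit 1)) ;;
    when (Cell table (Var vu) (Var vy) - Var vacc)%X
      (Assign vacc (Cell table (Var vu) (Var vy))) ;;
    when (Cell table (Var vv) (Var vy) - Var vacc)%X
      (Assign vacc (Cell table (Var vv) (Var vy))) ;;
    Put table (Var vu) (Var vy) (Var vacc)) ;;
  Put table (Var vu) (Lit 0) (Var vtotal).

(** Zero entries mark infeasible counts and must not enter the sum; the outermost test keeps the
    column [y - x] nonnegative. *)
Definition union_entry : cmd :=
  let sum := (Cell table (Var vu) (Var vx)
              + Cell table (Var vv) (Var vy - Var vx) - Lit 1)%X in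
  For vx (
    when (Var vy - Var vx + Lit 1)%X (
    when (Cell table (Var vu) (Var vx)) (
    when (Cell table (Var vv) (Var vy - Var vx)%X) (
    when (sum - Var vacc)%X (Assign vacc sum))))).

(* Counting [vy] down makes the update in place correct: the new entry [vy]
   depends only on entries up to [vy]. *)
Definition union_table : cmd :=
  For vy (
    Assign vacc (Lit 0) ;;
    union_entry ;;
    Put table (Var vu) (Var vy) (Var vacc)).

(* A vertex is alive as long as its table entry 0 is positive. *)
Definition merge_twins : cmd :=
  If (Cell adjacency (Var vu) (Var vv)) join_table union_table ;;
  Put table (Var vv) (Lit 0) (Lit 0) ;;
  Assign vz (Var vv) ;;
  shift.

(** [Negz 0] is -1: merged vertices leave the counts. Rounds that find no twins leave the arrays as
    they are. *)
Definition reduce : cmd :=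
  Assign vsign (Lit (Negz 0)) ;;
  For viter (find_twins ;; when (Var vfound) merge_twins).

(* A table has no entry for [n] black vertices, which leave no white one. *)
Definition answer : cmd :=
  Assign vfound (Lit 0) ;;
  when (Var vb + Lit 1)%X (
  when (Var vw + Lit 1)%X (
  If (Size - Var vb)%X
    (For vx (
      when (Cell table (Var vx) (Lit 0)) (
      when (Cell table (Var vx) (Var vb) - Var vw)%X (
        Assign vfound (Lit 1)))))
    (when (Lit 1 - Var vw)%X (
     when (Size + Lit 1 - Var vb)%X (
       Assign vfound (Lit 1)))))).

Arguments shift_row : simpl never.
Arguments shift : simpl never.
Arguments find_row : simpl never.
Arguments find_twins : simpl never.
Arguments join_table : simpl never.
Arguments union_entry : simpl never.
Arguments union_table : simpl never.
Arguments setup : simpl never.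
Arguments merge_twins : simpl never.
Arguments reduce : simpl never.
Arguments answer : simpl never.

Definition algorithm : cmd := setup ;; reduce ;; answer.

(** * Partitions into modules and their merging *)

Section Modules.

Variables (T : finType) (G : sgraph T).

Definition block (rep : T -> T) (u : T) : {set T} := [set x | rep x == u].

Definition alive (rep : T -> T) : {set T} := [set u | rep u == u].

(** The nonempty fibers of [rep] are modules containing their representatives, and the quotient is
    the subgraph induced on the fixed points. *)
Definition modular (rep : T -> T) : Prop :=
  (forall x, rep (rep x) = rep x) /\
  forall x y, rep x != rep y -> G x y = G (rep x) (rep y).

Definition merge (rep : T -> T) (u v x : T) : T :=
  if rep x == v then u else rep x.

Variables (rep : T -> T) (u v : T).
Hypotheses (rep_mod : modular rep) (u_alive : u \in alive rep)
  (v_alive : v \in alive rep) (uv : u != v)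
  (uv_twins : forall z, z \in alive rep -> z != u -> z != v -> G u z = G v z).

Lemma block_merge x :
  block (merge rep u v) x =
  if x == u then block rep u :|: block rep v else
  if x == v then set0 else block rep x.
Proof.
apply/setP => y; rewrite inE /merge.
case: (eqVneq x u) => [->|xu].
  by rewrite !inE; case: (rep y == v); rewrite ?eqxx ?orbT ?orbF.
case: (eqVneq x v) => [->|xv]; rewrite inE.
  by case: (eqVneq (rep y) v) => yv; [rewrite (negPf uv) | rewrite (negPf yv)].
case: (eqVneq (rep y) v) => [->|//].
by rewrite eq_sym (negPf xu) eq_sym (negPf xv).
Qed.

Lemma alive_merge : alive (merge rep u v) = alive rep :\ v.
Proof.
have ru : rep u = u by move: u_alive; rewrite inE => /eqP.
have rv : rep v = v by move: v_alive; rewrite inE => /eqP.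
apply/setP => x; rewrite !inE /merge.
case: (eqVneq x v) => [->|xv] /=; first by rewrite rv eqxx (negPf uv).
case: (eqVneq (rep x) v) => [rx|//]; rewrite rx.
have -> : (v == x) = false by rewrite eq_sym (negPf xv).
by apply/eqP => E; move: rx; rewrite -E ru => /eqP; rewrite (negPf uv).
Qed.

(** The block of [v] is now seen through [u], which changes nothing because the two are twins among
    the representatives. *)
Lemma modular_merge : modular (merge rep u v).
Proof.
have [rr H] := rep_mod.
have ru : rep u = u by move: u_alive; rewrite inE => /eqP.
split=> [x|x y]; rewrite /merge.
  case: (eqVneq (rep x) v) => [_|xv]; first by rewrite ru (negPf uv).
  by rewrite rr (negPf xv).
have al z : rep z \in alive rep by rewrite inE rr.
case: (eqVneq (rep x) v) => [xv|xv]; case: (eqVneq (rep y) v) => [yv|yv].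
- by rewrite eqxx.
- move=> uy; rewrite H; last by rewrite xv eq_sym.
  by rewrite xv -uv_twins // eq_sym.
- move=> xu; rewrite H; last by rewrite yv.
  by rewrite yv !(adj_sym G (rep x)) -uv_twins.
- exact: H.
Qed.

Lemma block_disjoint : [disjoint block rep u & block rep v].
Proof.
rewrite -setI_eq0; apply/eqP/setP => x; rewrite !inE.
by case: eqP => [->|//]; rewrite (negPf uv).
Qed.

Lemma block_adj x y : x \in block rep u -> y \in block rep v -> G x y = G u v.
Proof.
rewrite !inE => /eqP xu /eqP yv.
by rewrite rep_mod.2 xu ?yv.
Qed.

End Modules.

Ltac safe :=
  rewrite /= /in_range /= ?updateE /=;
  repeat match goal with
  | |- and3 _ _ _ => split
  | |- and5 _ _ _ _ _ => split
  | |- _ /\ _ => split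
  | |- True => exact I
  end; lia.

(** * Correctness of the phases of the algorithm *)

Section Correctness.

Variables (M n : nat) (G : sgraph 'I_n).
Hypothesis M_large : 10 * n + 10 <= M.

Definition adj_ok (s : env) : Prop :=
  forall x y : 'I_n, arr s adjacency x y = Posz (G x y).

Definition diffs_ok (S : {set 'I_n}) (s : env) : Prop :=
  forall x y : 'I_n, arr s diffs x y = Posz (diff G S x y).

(** A dead vertex may keep stale entries; in its row only entry 0 is prescribed. *)
Definition table_ok (rep : 'I_n -> 'I_n) (s : env) : Prop :=
  forall u b : 'I_n, if rep u == u then
      is_max G (block rep u) b (arr s table u b)
    else b = 0 :> nat -> arr s table u b = Posz 0.

Lemma wp_shift_row s Q (x z : 'I_n) (sg : int) :
  adj_ok s -> var s vx = Posz x -> var s vz = Posz z -> var s vsign = sg ->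
  `|sg|%N = 1 -> (forall y : 'I_n, `|arr s diffs x y|%N <= n) ->
  (forall s', frame [:: vy] [:: diffs] s s' ->
     (forall x' y : 'I_n, arr s' diffs x' y = (arr s diffs x' y +
        if x' == x then sg * Posz (G x z (+) G y z) else 0)%R) -> Q s') ->
  wp M n shift_row Q s.
Proof.
move=> adj sx sz ss sg1 bnd HQ.
apply: (wp_for (I := fun k s' => forall x' y : 'I_n,
  arr s' diffs x' y = (arr s diffs x' y +
    if (x' == x) && (k <= y)%N then sg * Posz (G x z (+) G y z)
    else 0)%R)) => //.
- by move=> x' y /=; rewrite leqNgt ltn_ord andbF GRing.addr0.
- move=> y s' [fv fa] I /=; rewrite ?updateE /=.
  rewrite (fa 0) // !fv // sx sz ss /= !adj.
  have := ltn_ord x; have := ltn_ord y; have := ltn_ord z => zn yn xn.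
  have := bnd y => by_.
  have Ixy : arr s' 1 x y = arr s 1 x y.
    by rewrite I ltnn andbF GRing.addr0.
  rewrite Ixy; split; [by safe | by case: (G x z); case: (G y z); safe |].
  move=> x' y'; rewrite I -!val_eqE /=.
  case: eqP => [/val_inj ->|_] //=.
  case: (eqVneq (val y') (val y)) => [/val_inj ->|ne].
    by rewrite leqnn; case: (G x z); case: (G y z); lia.
  by rewrite [y <= y']leq_eqVlt eq_sym (negPf ne).
- by move=> s' f I; apply: HQ => // x' y; rewrite I andbT.
Qed.

Lemma wp_shift s Q (z : 'I_n) (sg : int) :
  adj_ok s -> var s vz = Posz z -> var s vsign = sg -> `|sg|%N = 1 ->
  (forall x y : 'I_n, `|arr s diffs x y|%N <= n) ->
  (forall s', frame [:: vx; vy] [:: diffs] s s' ->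
     (forall x y : 'I_n, arr s' diffs x y =
       (arr s diffs x y + sg * Posz (G x z (+) G y z))%R) -> Q s') ->
  wp M n shift Q s.
Proof.
move=> adj sz ss sg1 bnd HQ.
apply: (wp_for (I := fun k s' => forall x y : 'I_n,
  arr s' diffs x y = (arr s diffs x y +
    if (k <= x)%N then sg * Posz (G x z (+) G y z) else 0)%R)) => //.
- by move=> x y /=; rewrite leqNgt ltn_ord GRing.addr0.
- move=> x s' [fv fa] I.
  apply: (wp_shift_row (x := x) (z := z) (sg := sg)) => //=.
  + by move=> x' y'; rewrite (fa 0).
  + by rewrite ?updateE /= fv.
  + by rewrite ?updateE /= fv.
  + by move=> y; rewrite I ltnn GRing.addr0.
  move=> s2 f2 E x' y; rewrite E I.
  case: (eqVneq x' x) => [->|ne]; first by rewrite leqnn ltnn GRing.addr0.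
  by rewrite [x <= x']leq_eqVlt val_eqE eq_sym (negPf ne) GRing.addr0.
Qed.

Lemma diffs_ok_bound S s :
  diffs_ok S s -> forall x y : 'I_n, `|arr s diffs x y|%N <= n.
Proof. by move=> H x y; rewrite H -[leqRHS](card_ord n) diff_le. Qed.

Definition initial_entry (b : nat) : int :=
  if b == 0 then Posz 2 else if b == 1 then Posz 1 else Posz 0.

Lemma wp_setup s Q :
  adj_ok s ->
  (forall x y : 'I_n, arr s diffs x y = Posz 0 /\ arr s table x y = Posz 0) ->
  (forall s', frame (mods setup) (writes setup) s s' ->
     diffs_ok [set: 'I_n] s' -> table_ok id s' -> Q s') ->
  wp M n setup Q s.
Proof.
move=> adj zero HQ; split; first by safe.
(* Since [vz] counts down, the counts at stage [k] range over the vertices from [k] on. *)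
apply: (wp_for (I := fun k s' => diffs_ok [set z : 'I_n | k <= z] s' /\
  forall u b : 'I_n, arr s' table u b =
    if k <= u then initial_entry b else Posz 0)) => //.
- split=> [x y|x y] /=; last by rewrite leqNgt ltn_ord (zero x y).2.
  rewrite (zero x y).1 /diff big_pred0 // => z.
  by rewrite inE leqNgt ltn_ord.
- move=> z s' [fv fa] [Id It].
  have zn := ltn_ord z.
  have sgn : var s' vsign = Posz 1 by rewrite fv.
  have It' : forall s2, arr s2 0 = arr s' 0 -> arr s2 1 = arr s' 1 ->
      var s2 vz = Posz z -> var s2 vsign = Posz 1 ->
      (forall u b : 'I_n, arr s2 table u b =
        if z <= u then initial_entry b else Posz 0) ->
      wp M n shift (fun s' => diffs_ok [set z0 : 'I_n | z <= z0] s' /\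
        forall u b : 'I_n, arr s' table u b =
          if z <= u then initial_entry b else Posz 0) s2.
    move=> s2 E0 E1 sz ss H2; apply: (wp_shift (z := z) (sg := Posz 1)) => //.
    + by move=> x y; rewrite E0 (fa 0) // adj.
    + by rewrite E1; apply: (diffs_ok_bound Id).
    move=> s3 [fv3 fa3] H3; split; last by move=> u b; rewrite fa3 // H2.
    move=> x y; rewrite H3 E1 Id (@diff_setD1 _ _ [set z0 : 'I_n | z <= z0] z);
      last by rewrite inE.
    have -> : [set z0 : 'I_n | z <= z0] :\ z = [set z0 : 'I_n | z < z0].
      by apply/setP => w; rewrite !inE ltn_neqAle -val_eqE /= eq_sym.
    by rewrite PoszD GRing.mul1r GRing.addrC.
  have tab : forall u b : 'I_n, arr s' table u b =
      if z < u then initial_entry b else Posz 0 by [].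
  split; [by safe | by safe |].
  split; first by safe.
  case: ifP => /= n1.
    split; [by safe | by safe |]; apply: It' => //=.
    move=> u b; rewrite tab /initial_entry.
    case: (ltngtP z u) => zu //=.
    by case: (nat_of_ord b) => [|[|]].
  apply: It' => //=.
  move=> u b; rewrite tab /initial_entry; have := ltn_ord b => bn.
  case: (ltngtP z u) => zu //=.
  by case: (nat_of_ord b) bn => [|[|]] //=; lia.
- move=> s' [fv fa] [Id It]; apply: HQ.
  + split=> [r rv|a av].
      move: rv; rewrite inE negb_or => /andP[r9 rv].
      by rewrite fv //= ?updateE (negPf r9).
    by rewrite fa.
  + by move=> x y; rewrite Id; congr (Posz (diff _ _ _ _));
      apply/setP => z; rewrite !inE.
  + move=> u b; rewrite eqxx It /=.
    have -> : block id u = [set u] by apply/setP => x; rewrite !inE.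
    exact: is_max_single.
Qed.

Section Step.

Variables (rep : 'I_n -> 'I_n) (s0 : env).
Hypotheses (rep_mod : modular G rep) (adj0 : adj_ok s0)
  (diffs0 : diffs_ok (alive rep) s0) (table0 : table_ok rep s0).

Lemma table_alive (u : 'I_n) :
  (0 < arr s0 table u 0)%R = (u \in alive rep).
Proof.
have n0 : 0 < n by apply: leq_ltn_trans (ltn_ord u).
have := table0 u (Ordinal n0); rewrite inE /=; case: eqP => _.
  by move=> /is_max_white ->.
by move=> ->.
Qed.

Definition found_ok (s : env) : Prop :=
  var s vfound = Posz 1 /\ exists u v : 'I_n,
    [/\ var s vu = Posz u, var s vv = Posz v,
        u \in alive rep /\ v \in alive rep, u != v
      & forall z, z \in alive rep -> z != u -> z != v -> G u z = G v z].

Definition no_twins (x y : 'I_n) : Prop :=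
  y < x -> x \in alive rep -> y \in alive rep ->
  ~~ (diff G (alive rep) x y <= 2 * G x y).

(** [C] carries through this row what the outer loop knows about earlier rows; it is given up only
    when twins are found. *)
Lemma wp_find_row s (x : 'I_n) (C : Prop) Q :
  (forall a, arr s a = arr s0 a) -> var s vx = Posz x ->
  found_ok s \/ (var s vfound = Posz 0 /\ C) ->
  (forall s', frame [:: vy; vu; vv; vfound] [::] s s' -> 
     found_ok s' \/ (var s' vfound = Posz 0 /\ C /\ forall y, no_twins x y) ->
     Q s') ->
  wp M n find_row Q s.
Proof.
move=> Es sx Hs HQ.
apply: (wp_for (I := fun k s' => found_ok s' \/
  (var s' vfound = Posz 0 /\ C /\ forall y : 'I_n, k <= y -> no_twins x y)))
  => //.
- case: Hs => [|[f c]]; [by left | right; split=> //; split=> // y].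
  by rewrite leqNgt ltn_ord.
- move=> y s' [fv fa] I.
  have xn := ltn_ord x; have yn := ltn_ord y.
  have sx' : var s' vx = Posz x by rewrite fv.
  have Ea a : arr s' a = arr s0 a by rewrite fa // Es.
  have next : no_twins x y -> found_ok (set_var s' vy (Posz y)) \/
      (var s' vfound = Posz 0 /\ C /\
       forall y' : 'I_n, y <= y' -> no_twins x y').
    case: I => [|[f [c H]]] H'; [by left | right; split=> //; split=> // y'].
    by rewrite leq_eqVlt => /orP[/eqP/val_inj <-//|]; apply: H.
  rewrite /= ?updateE /= sx' !Ea /=.
  split; first by safe.
  case: ifP => yx; last by apply: next => ?; lia.
  split; first by safe.
  rewrite table_alive; case: ifP => xa; last by apply: next => _; rewrite xa.
  split; first by safe.
  rewrite table_alive; case: ifP => ya; last by apply: next => _; rewrite ya.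
  rewrite diffs0 adj0.
  have bd : diff G (alive rep) x y <= n.
    by rewrite -[leqRHS](card_ord n) diff_le.
  split; first by case: (G x y); safe.
  have xy : x != y by rewrite -val_eqE /=; lia.
  case: ifP => le /=; last first.
    by apply: next => _ _ _; move: le; case: (G x y); lia.
  do 3 (split; first by safe).
  left; split=> //; exists x, y; split=> //=.
  apply/twins_diffP => //; move: le.
  by case: (G x y); move: (diff _ _ _ _) => d /=; lia.
- move=> s' f [I|[f0 [c I]]]; apply: HQ => //; [by left | right].
  by split=> //; split=> // y; apply: I.
Qed.

Lemma wp_find_twins s Q :
  (forall a, arr s a = arr s0 a) ->
  (forall s', frame (mods find_twins) (writes find_twins) s s' ->
     found_ok s' \/ (var s' vfound = Posz 0 /\ forall x y, no_twins x y) ->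
     Q s') ->
  wp M n find_twins Q s.
Proof.
move=> Es HQ; split; first by safe.
apply: (wp_for (I := fun k s' => found_ok s' \/
  (var s' vfound = Posz 0 /\ forall x y : 'I_n, k <= x -> no_twins x y))) => //.
- by right; split=> // x y; rewrite leqNgt ltn_ord.
- move=> x s' [fv fa] I.
  apply: (wp_find_row (x := x)
    (C := forall x' y : 'I_n, x < x' -> no_twins x' y)) => //=.
    by move=> a; rewrite -Es fa.
  move=> s2 f2 [H|[f [H1 H2]]]; [by left | right; split=> // x' y].
  by rewrite leq_eqVlt => /orP[/eqP/val_inj <-//|]; apply: H1.
- move=> s' [fv fa] I; apply: HQ.
  + split=> [r rv|a av]; last by rewrite fa.
    move: rv; rewrite inE negb_or => /andP[r9 rv].
    by rewrite fv //= ?updateE (negPf r9).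
  + by case: I => [|[f H]]; [by left | right; split=> // x y; apply: H].
Qed.

End Step.

Lemma wp_union_entry s Q (u v y : 'I_n) :
  let g1 k := arr s table u k in let g2 k := arr s table v k in
  var s vu = Posz u -> var s vv = Posz v -> var s vy = Posz y ->
  var s vacc = Posz 0 ->
  (forall k : 'I_n, (0 <= g1 k)%R && (g1 k <= Posz n.+1)%R) ->
  (forall k : 'I_n, (0 <= g2 k)%R && (g2 k <= Posz n.+1)%R) ->
  (forall s', frame (mods union_entry) (writes union_entry) s s' ->
     (0 <= var s' vacc)%R && (var s' vacc <= Posz (n.*2 + 2))%R ->
     (forall w : nat, (Posz w < var s' vacc)%R <->
       exists k, [/\ k <= y, (0 < g1 k)%R, (0 < g2 (y - k)%N)%R
         & (Posz w < g1 k + g2 (y - k)%N - 1)%R]) -> Q s') ->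
  wp M n union_entry Q s.
Proof.
move=> g1 g2 su sv sy sa b1 b2 HQ.
apply: (wp_for (I := fun k s' =>
  (0 <= var s' vacc)%R && (var s' vacc <= Posz (n.*2 + 2))%R /\
  forall w : nat, (Posz w < var s' vacc)%R <->
    exists j, [/\ k <= j <= y, (0 < g1 j)%R, (0 < g2 (y - j)%N)%R
      & (Posz w < g1 j + g2 (y - j)%N - 1)%R])) => //.
- rewrite /= ?updateE /= sa; split=> [|w]; first by lia.
  by split=> [|[j []]]; have := ltn_ord y; lia.
- move=> x s' [fv fa] [Ib I].
  have yn := ltn_ord y; have xn := ltn_ord x; have un := ltn_ord u.
  have vn := ltn_ord v.
  (* Common end of the branches that leave the accumulator alone: the candidate [x] is infeasible or
     no improvement. *)
  have next : (x <= y -> (0 < g1 x)%R -> (0 < g2 (y - x)%N)%R ->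
      (g1 x + g2 (y - x)%N - 1 <= var s' vacc)%R) ->
    (0 <= var s' vacc)%R && (var s' vacc <= Posz (n.*2 + 2))%R /\
    forall w : nat, (Posz w < var s' vacc)%R <->
      exists j, [/\ x <= j <= y, (0 < g1 j)%R, (0 < g2 (y - j)%N)%R
        & (Posz w < g1 j + g2 (y - j)%N - 1)%R].
    move=> H; split=> // w; rewrite I; split=> -[j [jy p1 p2 lt]].
      by exists j; split=> //; lia.
    have [E|ne] := eqVneq (x : nat) j; last by exists j; split=> //; lia.
    by apply/I; subst j; have := H _ p1 p2; lia.
  rewrite /= ?updateE /= (fv vu) // (fv vv) // (fv vy) // !fa // su sv sy /=.
  rewrite -/(g1 x).
  have cut : x <= y -> `|Posz y - Posz x|%N = y - x by lia.
  split; first by safe.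
  case: ifP => xy /=; last by apply: next; lia.
  rewrite cut; last by lia.
  rewrite -/(g2 (y - x)).
  split; first by safe.
  case: ifP => p1 /=; last by apply: next; lia.
  split; first by safe.
  case: ifP => p2 /=; last by apply: next; lia.
  have := b1 x; have lt : y - x < n by lia.
  have := b2 (Ordinal lt) => /= b2x b1x.
  split; first by safe.
  case: ifP => c /=; last by apply: next; lia.
  rewrite ?updateE /=; split; first by safe.
  split; first by lia.
  move=> w; split=> [lw|[j [jy q1 q2 lw]]].
    by exists x; split=> //; lia.
  have [E|ne] := eqVneq (x : nat) j; first by subst j.
  suff : (Posz w < var s' vacc)%R by lia.
  by apply/I; exists j; split=> //; lia.
- by move=> s' f [Ib I]; apply: HQ.
Qed.

Lemma is_max_bounds (M' : {set 'I_n}) b z :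
  is_max G M' b z -> (0 <= z)%R && (z <= Posz n.+1)%R.
Proof.
move=> H; have := is_max_le H; case: H => -> _ /=.
have := subset_leq_card (subsetT M'); rewrite cardsT card_ord.
by move: #|_| => k; lia.
Qed.

Section Tables.

Variables (M1 M2 : {set 'I_n}) (s : env) (u v : 'I_n).
Hypotheses (su : var s vu = Posz u) (sv : var s vv = Posz v) (uv : u != v)
  (dis : [disjoint M1 & M2])
  (max1 : forall b : 'I_n, is_max G M1 b (arr s table u b))
  (max2 : forall b : 'I_n, is_max G M2 b (arr s table v b)).

Lemma wp_union_table Q :
  (forall x y, x \in M1 -> y \in M2 -> G x y = false) ->
  (forall s', frame (mods union_table) (writes union_table) s s' ->
     (forall b : 'I_n, is_max G (M1 :|: M2) b (arr s' table u b)) ->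
     (forall x b : 'I_n, x != u -> arr s' table x b = arr s table x b) ->
     Q s') ->
  wp M n union_table Q s.
Proof.
move=> noadj HQ.
apply: (wp_for (I := fun k s' =>
  (forall b : 'I_n, if k <= b then
      is_max G (M1 :|: M2) b (arr s' table u b)
    else arr s' table u b = arr s table u b) /\
  forall x b : 'I_n, x != u -> arr s' table x b = arr s table x b)) => //.
- by split=> // b; rewrite leqNgt ltn_ord.
- move=> y s' [fv fa] [I1 I2].
  have yn := ltn_ord y; have un := ltn_ord u.
  have E1 (k : 'I_n) : k <= y -> arr s' table u k = arr s table u k.
    by move=> ky; have := I1 k; rewrite ltnNge ky.
  have E2 (k : 'I_n) : arr s' table v k = arr s table v k.
    by rewrite I2 // eq_sym.
  have B1 (k : 'I_n) :
      (0 <= arr s' table u k)%R && (arr s' table u k <= Posz n.+1)%R.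
    have := I1 k; case: ifP => _; first exact: is_max_bounds.
    by move=> ->; exact: is_max_bounds (max1 k).
  split; first by safe.
  apply: (wp_union_entry (u := u) (v := v) (y := y)) => //=;
    rewrite ?updateE ?fv //=.
    by move=> k; rewrite E2; exact: is_max_bounds (max2 k).
  move=> s2 [fv2 fa2] bnd Hw; rewrite fv2 // fv2 //= ?updateE /= fv // su /=.
  split; [by safe | by safe |].
  split=> [b|x b xu] /=; last first.
    rewrite (_ : (x == u :> nat) = false) /= ?fa2 //= ?I2 //.
    by apply: negPf; rewrite val_eqE.
  rewrite eqxx /=; case: (ltngtP y b) => yb //=; last first.
  + have <- : y = b by apply: val_inj.
    rewrite ?eqxx.
    apply: (is_max_union (g1 := arr s table u) (g2 := arr s table v)) => //.
    * by move=> k ky; apply: (max1 (Ordinal (leq_ltn_trans ky yn))).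
    * by move=> k ky; apply: (max2 (Ordinal (leq_ltn_trans ky yn))).
    * by lia.
    move=> w; rewrite Hw.
    have F1 k : k <= y -> arr s' table u k = arr s table u k.
      by move=> ky; apply: (E1 (Ordinal (leq_ltn_trans ky yn))).
    have F2 k : k <= y -> arr s' table v k = arr s table v k.
      by move=> ky; apply: (E2 (Ordinal (leq_ltn_trans ky yn))).
    split=> -[k [ky]]; rewrite ?F1 ?F2 ?leq_subr // => ? ? ?; exists k;
      by rewrite ?F1 ?F2 ?leq_subr.
  + rewrite ?fa2 //.
    by have := I1 b; rewrite ltnNge (ltnW yb).
  + rewrite ?fa2 //.
    by have := I1 b; rewrite yb.
- by move=> s' f [I1 I2]; apply: HQ.
Qed.

Lemma wp_join_table Q :
  (forall x y, x \in M1 -> y \in M2 -> G x y) ->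
  (forall s', frame (mods join_table) (writes join_table) s s' ->
     (forall b : 'I_n, is_max G (M1 :|: M2) b (arr s' table u b)) ->
     (forall x b : 'I_n, x != u -> arr s' table x b = arr s table x b) ->
     Q s') ->
  wp M n join_table Q s.
Proof.
move=> alladj HQ.
suff /wp_frame : wp M n join_table (fun s' =>
    (forall b : 'I_n, is_max G (M1 :|: M2) b (arr s' table u b)) /\
    forall x b : 'I_n, x != u -> arr s' table x b = arr s table x b) s.
  by apply: wp_mono => s' [[H1 H2] f]; apply: HQ.
move=> {Q HQ}.
have un := ltn_ord u; have vn := ltn_ord v.
have n0 : 0 < n by apply: leq_ltn_trans un.
have /is_max_white W1 := max1 (Ordinal n0).
have /is_max_white W2 := max2 (Ordinal n0).
have cU : #|M1 :|: M2| = #|M1| + #|M2|.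
  by rewrite cardsU (_ : M1 :&: M2 = set0) ?cards0 ?subn0 //;
    apply/eqP; rewrite setI_eq0.
have := subset_leq_card (subsetT (M1 :|: M2)); rewrite cardsT card_ord => cn.
rewrite cU in cn.
move: #|M1| #|M2| W1 W2 cU cn => k1 k2 W1 W2 cU cn.
split; first by rewrite /= su sv /= W1 W2; safe.
set s1 := set_var _ _ _.
have tot : var s1 vtotal = Posz #|M1 :|: M2|.+1.
  by rewrite /= ?updateE /= su sv /= W1 W2 cU; lia.
(* Column 0 is exempt: [is_max_join] needs a black vertex, and the last assignment overwrites that
   entry. *)
apply: (wp_for (I := fun k s' =>
  (forall b : 'I_n, if k <= b then
      0 < b -> is_max G (M1 :|: M2) b (arr s' table u b)
    else arr s' table u b = arr s table u b) /\
  forall x b : 'I_n, x != u -> arr s' table x b = arr s table x b)) => //.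
- by split=> // b; rewrite leqNgt ltn_ord.
- move=> y s' [fv fa] [I1 I2].
  have yn := ltn_ord y.
  have B1 := is_max_bounds (max1 y); have B2 := is_max_bounds (max2 y).
  have E1 : arr s' table u y = arr s table u y.
    by have := I1 y; rewrite ltnn.
  have E2 : arr s' table v y = arr s table v y by rewrite I2 // eq_sym.
  have tot' : var s' vtotal = Posz #|M1 :|: M2|.+1 by rewrite fv.
  have su' : var s' vu = Posz u by rewrite fv.
  have sv' : var s' vv = Posz v by rewrite fv.
  (* Whatever the three conditionals do, the stored value dominates all candidates and is one of
     them or 0. *)
  have entry z :
      (arr s table u y <= z)%R -> (arr s table v y <= z)%R ->
      (y <= k1 + k2 -> (0 < z)%R) ->
      z = arr s table u y \/ z = arr s table v y \/ z = Posz 0 \/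
        z = Posz 1 /\ y <= k1 + k2 ->
      (forall b : 'I_n, if y <= b then
          0 < b -> is_max G (M1 :|: M2) b
            (if (u == u :> nat) && (b == y :> nat) then z else arr s' table u b)
        else (if (u == u :> nat) && (b == y :> nat) then z
              else arr s' table u b) = arr s table u b) /\
      forall x b : 'I_n, x != u ->
        (if (x == u :> nat) && (b == y :> nat) then z else arr s' table x b) =
        arr s table x b.
    move=> z1 z2 z3 z4; split=> [b|x b xu] /=; last first.
      rewrite (_ : (x == u :> nat) = false) ?I2 //.
      by apply: negPf; rewrite val_eqE.
    rewrite eqxx /=; case: (ltngtP y b) => yb //=; last first.
    + have <- : y = b by apply: val_inj.
      rewrite ?eqxx => y0.
      apply: (is_max_join y0 alladj (max1 y) (max2 y)); first by lia.
      move=> w; rewrite cU; split=> [lw|[[-> /z3]||]]; [|by []|by lia|by lia].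
      case: z4 => [E|[E|[E|[E yk]]]]; subst z.
      * by constructor 2.
      * by constructor 3.
      * by lia.
      * by constructor 1; split=> //; lia.
    + by have := I1 b; rewrite ltnNge (ltnW yb).
    + by have := I1 b; rewrite yb.
  rewrite cU in tot'.
  rewrite /= ?updateE /= tot' su' sv' /= E1 E2.
  split; first by safe.
  split; first by safe.
  case: ifP => c1 /=; [split; first by safe|]; (split; first by safe);
    (case: ifP => c2 /=; [split; first by safe|]); (split; first by safe);
    (case: ifP => c3 /=; [split; first by safe|]);
    (split; [by safe | by safe | apply: entry; lia]).
- move=> s' [fv fa] [I1 I2].
  have su1 : var s1 vu = Posz u by rewrite /= ?updateE /= su.
  rewrite /= (fv vu) // (fv vtotal) // tot su1 /=.
  split; [by safe | by safe |].
  split=> [b|x b xu] /=.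
  + rewrite eqxx /=; case: eqP => [->|b0]; first exact/is_max_white.
    by apply: (I1 b); lia.
  + rewrite (_ : (x == u :> nat) = false) ?I2 //.
    by apply: negPf; rewrite val_eqE.
Qed.

End Tables.

Definition inv (rep : 'I_n -> 'I_n) (s : env) : Prop :=
  [/\ modular G rep, adj_ok s, diffs_ok (alive rep) s & table_ok rep s].

Lemma inv_ext rep s s' :
  (forall a, arr s' a = arr s a) -> inv rep s -> inv rep s'.
Proof.
move=> E [rm adj df tb]; split=> // [x y|x y|u b]; rewrite E //.
exact: tb.
Qed.

Lemma wp_merge_twins rep s (u v : 'I_n) Q :
  inv rep s -> var s vsign = Negz 0 ->
  var s vu = Posz u -> var s vv = Posz v ->
  u \in alive rep -> v \in alive rep -> u != v ->
  (forall z, z \in alive rep -> z != u -> z != v -> G u z = G v z) ->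
  (forall s', frame (mods merge_twins) (writes merge_twins) s s' ->
     inv (merge rep u v) s' -> Q s') ->
  wp M n merge_twins Q s.
Proof.
move=> [rm adj df tb] sg su sv ua va uv tw HQ.
suff /wp_frame : wp M n merge_twins (fun s' =>
    diffs_ok (alive rep :\ v) s' /\ table_ok (merge rep u v) s') s.
  apply: wp_mono => s' [[H1 H2] f]; apply: HQ => //; split=> //.
  - exact: modular_merge.
  - by move=> x y; rewrite f.2.
  - by rewrite alive_merge.
have un := ltn_ord u; have vn := ltn_ord v.
have n0 : 0 < n by apply: leq_ltn_trans un.
have al x : (rep x == x) = (x \in alive rep) by rewrite inE.
have max_of (x b : 'I_n) : x \in alive rep ->
    is_max G (block rep x) b (arr s table x b).
  by move=> xa; have := tb x b; rewrite al xa.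
(* The tail shared by join and union kills [v]; it asks only that the row of [u] be combined and the
   other rows be untouched. *)
have rest s1 : var s1 vv = Posz v -> var s1 vsign = Negz 0 ->
    arr s1 adjacency = arr s adjacency -> arr s1 diffs = arr s diffs ->
    (forall b : 'I_n,
       is_max G (block rep u :|: block rep v) b (arr s1 table u b)) ->
    (forall x b : 'I_n, x != u -> arr s1 table x b = arr s table x b) ->
    wp M n (Put table (Var vv) (Lit 0) (Lit 0) ;; Assign vz (Var vv) ;; shift)
      (fun s' => diffs_ok (alive rep :\ v) s' /\ table_ok (merge rep u v) s')
      s1.
  move=> s1v s1s E0 E1 Tu Tx.
  rewrite /= s1v; split; [by safe | by safe |].
  split; first by safe.
  apply: (wp_shift (z := v) (sg := Negz 0)) => //=.
  - by move=> x y /=; rewrite E0.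
  - by move=> x y; rewrite E1; apply: diffs_ok_bound df x y.
  move=> s2 [_ fa2] H2; split=> [x y|x b].
    rewrite H2 /= E1 df (diff_setD1 _ _ _ va).
    by case: (G x v (+) G y v) => /=; move: (diff _ _ _ _) => d; lia.
  have <- : (x \in alive (merge rep u v)) = (merge rep u v x == x).
    by rewrite inE.
  rewrite alive_merge // block_merge // !inE fa2 //= al.
  case: (eqVneq x v) => [->|xv] /=; first by rewrite eqxx => ->.
  rewrite (_ : (x == v :> nat) = false) /=; last first.
    by apply: negPf; rewrite val_eqE.
  case: (eqVneq x u) => [->|xu]; first by rewrite ua.
  by rewrite Tx //; have := tb x b; rewrite al.
split; first by rewrite /= su sv; safe.
have -> : ev n (Cell adjacency (Var vu) (Var vv)) s = Posz (G u v).
  by rewrite /= su sv /= adj.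
have dis := block_disjoint rep uv.
have adj_uv x y : x \in block rep u -> y \in block rep v -> G x y = G u v.
  exact: block_adj.
case: ifP => Guv.
  apply: (wp_join_table su sv uv dis) => [b|b|x y xu yv|s' [fv fa] H1 H2].
  - exact: max_of.
  - exact: max_of.
  - by rewrite adj_uv //; move: Guv; case: (G u v).
  - by apply: rest => //; rewrite ?fv ?fa //.
apply: (wp_union_table su sv uv dis) => [b|b|x y xu yv|s' [fv fa] H1 H2].
- exact: max_of.
- exact: max_of.
- by rewrite adj_uv //; move: Guv; case: (G u v).
- by apply: rest => //; rewrite ?fv ?fa //.
Qed.

Lemma wp_reduce s Q :
  cograph G -> inv id s ->
  (forall s', frame (mods reduce) (writes reduce) s s' ->
     forall rep, inv rep s' -> #|alive rep| <= 1 -> Q s') ->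
  wp M n reduce Q s.
Proof.
move=> coG inv0 HQ.
suff /wp_frame : wp M n reduce (fun s' =>
    exists2 rep, inv rep s' & #|alive rep| <= 1) s.
  by apply: wp_mono => s' [[rep H1 H2] f]; apply: HQ H1 H2.
split; first by safe.
(* A round either loses a live vertex or finds no twins, and then [cograph_twins] leaves at most one
   alive; so the bound falls with the counter down to 1. *)
apply: (wp_for (I := fun k s' =>
  exists2 rep, inv rep s' & #|alive rep| <= maxn 1 k)) => //.
  exists id; first exact: inv_ext inv0.
  have := subset_leq_card (subsetT (alive (id : 'I_n -> 'I_n))).
  by rewrite cardsT card_ord leq_max => ->; rewrite orbT.
move=> k s' [fv fa] [rep Hinv card_le].
have Hinv1 : inv rep (set_var s' viter (Posz k)) by exact: inv_ext Hinv.
have [rm adj df tb] := Hinv1.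
apply: (wp_find_twins adj df tb) => // s1 [fv1 fa1] found.
have Hinv2 : inv rep s1 by apply: inv_ext Hinv1 => a; rewrite fa1.
split; first by safe.
case: found => [[f1 [u [v [su sv [ua va] uv tw]]]]|[f0 none]].
  rewrite [ev _ _ _]f1 (_ : (0 < Posz 1)%R = true) //.
  apply: (wp_merge_twins Hinv2 _ su sv ua va uv tw).
    by rewrite fv1 //= ?updateE /= fv.
  move=> s2 _ Hinv3; exists (merge rep u v) => //.
  by move: card_le; rewrite alive_merge // (cardsD1 v) va; lia.
rewrite /= f0 /=; exists rep => //.
rewrite leq_max; apply/orP; left; rewrite leqNgt; apply/negP => gt1.
have [x [y [xa ya xy tw]]] := cograph_twins coG gt1.
(* The search visits only pairs in this order, and twins may be swapped. *)
wlog yx : x y xa ya xy tw / y < x.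
  move=> H; case: (ltngtP y x) => [|lt|E]; first exact: (H x y).
    apply: (H y x) => //; first by rewrite eq_sym.
    by move=> z za zy zx; rewrite tw.
  by move: xy; rewrite -val_eqE /= E eqxx.
have /negP := none x y yx xa ya; apply.
exact/twins_diffP.
Qed.

Lemma wp_answer s Q rep :
  inv rep s -> #|alive rep| <= 1 ->
  `|var s vb|%N + n + 2 <= M -> `|var s vw|%N + n + 2 <= M ->
  (forall s',
     ((0 < var s' vfound)%R <-> bw_colorable G (var s vb) (var s vw)) ->
     Q s') ->
  wp M n answer Q s.
Proof.
move=> [rm adj df tb] alive1 bM wM HQ.
have al x : (rep x == x) = (x \in alive rep) by rewrite inE.
have nat_of := @bw_colorable_nat _ G (var s vb) (var s vw).
split; first by safe.
set s1 := set_var _ _ _.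
have [Eb Ew] : var s1 vb = var s vb /\ var s1 vw = var s vw by [].
have E0 : var s1 vfound = Posz 0 by [].
have E a : arr s1 a = arr s a by [].
move: s1 Eb Ew E0 E => s1 Eb Ew E0 E.
split; first by rewrite /= Eb; safe.
case: ifP => b0; rewrite /= Eb in b0; last first.
  by apply: HQ; rewrite E0; split=> // /nat_of; lia.
split; first by rewrite /= Ew; safe.
case: ifP => w0; rewrite /= Ew in w0; last first.
  by apply: HQ; rewrite E0; split=> // /nat_of; lia.
have [b bE] : exists b : nat, var s vb = Posz b by exists `|var s vb|%N; lia.
have [w wE] : exists w : nat, var s vw = Posz w by exists `|var s vw|%N; lia.
rewrite bE wE in HQ bM wM.
split; first by rewrite /= Eb bE; safe.
case: ifP => bn; rewrite /= Eb bE in bn; last first.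
  have col_n : bw_colorable G (Posz b) (Posz w) <-> w = 0 /\ b <= n.
    rewrite -col_colorable; split=> [/col_card|[-> ?]].
      by rewrite cardsT card_ord; lia.
    by apply/col_black; rewrite cardsT card_ord.
  split; first by rewrite /= Ew wE; safe.
  case: ifP => w1; rewrite /= Ew wE in w1; last first.
    by apply: HQ; rewrite E0 col_n; split=> //; lia.
  split; first by rewrite /= Eb bE; safe.
  case: ifP => b1; rewrite /= Eb bE in b1; last first.
    by apply: HQ; rewrite E0 col_n; split=> //; lia.
  split; first by safe.
  by apply: HQ; rewrite /= ?updateE /= col_n; split=> //; lia.
have bn' : b < n by lia.
pose B := Ordinal bn'.
apply: (wp_for (I := fun k s' => (0 < var s' vfound)%R <->
  exists x : 'I_n, [/\ k <= x, x \in alive rep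
    & (Posz w < arr s table x b)%R])) => //.
- rewrite /= ?updateE /= E0; split=> // -[x []].
  by rewrite leqNgt ltn_ord.
- move=> x s' [fv fa] I; have xn := ltn_ord x.
  have next : ((x \in alive rep) -> (Posz w < arr s table x b)%R ->
      (0 < var s' vfound)%R) ->
    (0 < var s' vfound)%R <-> exists x' : 'I_n, [/\ x <= x',
      x' \in alive rep & (Posz w < arr s table x' b)%R].
    move=> H; split=> [/I[x' [xx' xa lt]]|[x' [xx' xa lt]]].
      by exists x'; split=> //; apply: ltnW.
    have [E'|ne] := eqVneq x x'; first by subst x'; apply: H.
    by apply/I; exists x'; split=> //; rewrite ltn_neqAle val_eqE ne.
  rewrite /= ?updateE /= (fv vb) // (fv vw) // !fa // !E Eb Ew bE wE /=.
  split; first by safe.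
  rewrite (table_alive tb); case: ifP => xa; last by apply: next; rewrite xa.
  have := tb x B; rewrite al xa /= => /is_max_bounds bnd.
  split; first by safe.
  case: ifP => lt; last by apply: next; lia.
  rewrite ?updateE /=; split; first by safe.
  by split=> // _; exists x; split=> //; lia.
- move=> s' f I; apply: HQ; rewrite I -col_colorable.
  split=> [[x [_ xa lt]]|H].
    have := tb x B; rewrite al xa => -[_ /(_ w)[_ /(_ lt)]].
    by apply: col_sub; apply: subsetT.
  (* The column [B] serves here as a vertex, available because [b < n]; its representative is the
     only live vertex and has the whole graph as block. *)
  pose x := rep B.
  have xa : x \in alive rep by rewrite inE /x rm.1.
  exists x; split=> //.
  have := tb x B; rewrite al xa => -[_ /(_ w)[+ _]]; apply.
  rewrite (_ : block rep x = [set: 'I_n]) //.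
  apply/setP => y; rewrite !inE; apply/eqP.
  by apply: (card_le1_eqP alive1); rewrite // inE rm.1.
Qed.

End Correctness.
(** * Running the algorithm on an encoded graph *)

Lemma nth_allpairs (S T R : Type) (f : S -> T -> R) (s : seq S) (t : seq T)
    x0 y0 z0 i j :
  i < size s -> j < size t ->
  nth z0 [seq f x y | x <- s, y <- t] (i * size t + j) =
  f (nth x0 s i) (nth y0 t j).
Proof.
move=> + jt; elim: s i => //= x s IH [|i] lt_i; rewrite nth_cat size_map.
  by rewrite jt (nth_map y0).
by rewrite mulSn -addnA ltnNge leq_addr /= addKn IH.
Qed.

Section Encoding.

Variables (n : nat) (G : sgraph 'I_n) (b w : int).

Let input := encode G b w.

Lemma size_encode : size input = 3 + n * n.
Proof. by rewrite /= size_allpairs size_enum_ord. Qed.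

Lemma nth_encode_adj (x y : 'I_n) :
  nth 0%R input (addr n adjacency x y) = Posz (G x y).
Proof.
have /= := nth_allpairs (fun i j => Posz (G i j)) x y 0%R
  (s := enum 'I_n) (t := enum 'I_n).
rewrite size_enum_ord => /(_ _ _ (ltn_ord x) (ltn_ord y)).
by rewrite !nth_ord_enum.
Qed.

(** Counts and tables lie behind the input, where memory reads as 0, so they need no clearing. *)
Lemma nth_encode_rest a (x y : nat) :
  0 < a -> nth 0%R input (addr n a x y) = 0%R.
Proof.
by move=> a0; rewrite nth_default // size_encode /addr; nia.
Qed.

Lemma leq_max_encode z : z \in input -> `|z|%N <= \max_(z <- input) `|z|%N.
Proof. by move=> zi; rewrite (big_rem z) //= leq_maxl. Qed.

Lemma word_bound_large :
  let M := word_bound 2 input in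
  [/\ 3 * n * n + 2 * n + 3 <= M, 10 * n + 10 <= M,
      `|b|%N + n + 2 <= M, `|w|%N + n + 2 <= M
    & forall k, `|nth 0%R input k|%N <= M].
Proof.
rewrite /word_bound size_encode.
have mn : n <= \max_(z <- input) `|z|%N.
  by apply: (leq_max_encode (z := Posz n)); rewrite inE eqxx.
have mb : `|b|%N <= \max_(z <- input) `|z|%N.
  by apply: leq_max_encode; rewrite !inE eqxx orbT.
have mw : `|w|%N <= \max_(z <- input) `|z|%N.
  by apply: leq_max_encode; rewrite !inE eqxx !orbT.
have mk k : `|nth 0%R input k|%N <= \max_(z <- input) `|z|%N.
  have [lt|ge] := ltnP k (size input); first exact/leq_max_encode/mem_nth.
  by rewrite nth_default.
move: (\max_(_ <- _) _) mn mb mw mk => m mn mb mw mk.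
(* With [a = n * n + m] the base is [a + 5], and [10 * a] is the cross term of its square. *)
have large : n * n * 10 + 10 * m + 10 <= (3 + n * n + m + 2) ^ 2 by nia.
split; [by nia | by nia | by nia | by nia |].
by move=> k; apply: leq_trans (mk k) _; nia.
Qed.

End Encoding.

(** Registers 1, 2 and 0 receive [n], [w] and [b], as the compiled code expects. Register 0 first
    serves for addresses, so [b] is loaded last. *)
Definition prologue : program :=
  [:: Const 0 (Posz 0); Read 1 0; Const 2 (Posz 2); Read 2 2;
      Const 0 (Posz 1); Read 0 0].

Definition body : program := comp algorithm (size prologue).

Definition epilogue : program :=
  [:: JumpPos vfound.*2 (size prologue + size body + 2); Halt false; Halt true].

Definition ram_program : program := prologue ++ body ++ epilogue.

Definition load_env (n : nat) (s : state) : env :=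
  Env (fun r => reg s r.*2) (fun a x y => memory s (addr n a x y)).

Theorem theorem2 :
  exists (c : nat) (P : program) (T : nat -> nat),
    bigO T (fun n => n ^ 3) /\
    forall (n : nat) (G : sgraph 'I_n) (b w : int),
      cograph G ->
      decides_within c P (encode G b w) (T n) (bw_colorable G b w).
Proof.
(* The prologue takes 6 steps, the final jump and halt 2; these 8 reappear in the constant
   [k + 8]. *)
exists 2, ram_program, (fun n => 6 + (cost n algorithm + 2)); split.
  have [k Hk] := cost_bigO algorithm.
  have d3 : depth algorithm = 3 by [].
  exists (k + 8), 1 => n n1; have := Hk n n1; rewrite d3.
  have : 0 < n ^ 3 by rewrite expn_gt0 n1.
  by move: (cost _ _) (n ^ 3) => C N; nia.
move=> n G b w coG.
have [M1 M2 Mb Mw Mk] := word_bound_large G b w.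
rewrite /decides_within.
move: (word_bound _ _) M1 M2 Mb Mw Mk => M M1 M2 Mb Mw Mk.
have n0 : code_at ram_program 0 ram_program by [].
have [Hp Hbe] := code_at_cat n0.
set x := encode G b w in Mk *.
have [|s1 R1 [{}Hp c1 m1 r1]] := @run_const M ram_program (init x) 0 0 _ n0.
  by [].
have E1 : reg s1 0 = Posz 0 by rewrite r1.
have [|s2 R2 [{}Hp c2 m2 r2]] := run_read (M := M) Hp E1.
  by rewrite m1 /=; exact: (Mk 0).
have [|s3 R3 [{}Hp c3 m3 r3]] := run_const (M := M) Hp; first by lia.
have E3 : reg s3 2 = Posz 2 by rewrite r3.
have [|s4 R4 [{}Hp c4 m4 r4]] := run_read (M := M) Hp E3.
  by rewrite m3 m2 m1; exact: (Mk 2).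
have [|s5 R5 [{}Hp c5 m5 r5]] := run_const (M := M) Hp; first by lia.
have E5 : reg s5 0 = Posz 1 by rewrite r5.
have [|s6 R6 [{}Hp c6 m6 r6]] := run_read (M := M) Hp E5.
  by rewrite m5 m4 m3 m2 m1; exact: (Mk 1).
have R : reaches M ram_program 6 (init x) s6.
  have := reaches_trans (reaches_trans R1 R2) (reaches_trans R3 R4).
  by move=> /reaches_trans; apply; apply: reaches_trans R5 R6.
have mem6 : memory s6 = fun k => nth 0%R x k.
  by rewrite m6 m5 m4 m3 m2 m1.
have reg6 r : reg s6 r = if r == 0 then b else if r == 2 then w
    else if r == 1 then Posz n else 0%R.
  rewrite r6 r5 r4 r3 r2 r1 m5 m4 m3 m2 m1 /update /=.
  by case: r => [|[|[|r]]].
pose e := load_env n s6.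
have Hsim : simulates M n e s6.
  split=> //= [r|a i j a3 iltn jltn].
  - by rewrite reg6; do ! case: ifP => _ //; lia.
  - by rewrite mem6; apply: Mk.
have adj : adj_ok G e by move=> i j; rewrite /= mem6 nth_encode_adj.
have H : wp M n algorithm
    (fun s => (0 < var s vfound)%R <-> bw_colorable G b w) e.
  apply: (wp_setup M2 adj) => [i j|s' f df tb].
    by rewrite /= mem6 !nth_encode_rest.
  have Hinv : inv G id s'.
    split=> //.
    - by move=> i j; rewrite f.2 // adj.
    - by have -> : alive id = [set: 'I_n] by apply/setP => i; rewrite !inE eqxx.
  apply: (wp_reduce M2 coG Hinv) => s'' f' rep Hinv' al.
  have eb : var s'' vb = b by rewrite f'.1 // f.1 //= reg6.
  have ew : var s'' vw = w by rewrite f'.1 // f.1 //= reg6.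
  by apply: (wp_answer M2 Hinv' al); rewrite ?eb ?ew.
have pc6 : pc s6 = size prologue by rewrite c6 c5 c4 c3 c2 c1.
have Hb : code_at ram_program (pc s6) (comp algorithm (pc s6) ++ epilogue).
  by rewrite pc6.
have [t [s7 [e7 [[le7 R7] He c7 H7 Hs7]]]] := run_cmd M1 H Hsim Hb.
have [J /code_at_cons[Hf /code_at_cons[Ht _]]] := code_at_cons He.
have [s8 R8 [c8 r8 m8]] := run_jump M J.
have run_all : run M ram_program (6 + (cost n algorithm + 2)) (init x) =
    run M ram_program ((cost n algorithm - t).+1) s8.
  (* The compiled body may stop early; [cost n algorithm - t] is fuel left over beyond the jump and
     the halt. *)
  rewrite (_ : _ + _ = 6 + (t + (1 + (cost n algorithm - t).+1))); last by lia.
  by rewrite R R7 R8.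
have Efound : reg s7 vfound.*2 = var e7 vfound by case: Hs7.
exists (0 < var e7 vfound)%R => //.
rewrite run_all /= /step c8 Efound.
case: ifP => pos; last by rewrite Hf.
have <- : (pc s7).+2 = size prologue + size body + 2.
  by rewrite c7 pc6 addn2.
by rewrite Ht.
Qed.
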